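(* Let $\psi^{(r)}=\psi^{(e)}$ be a real-valued admissible wavelet that is isotropic (radially symmetric), let $\psi^{(+)}$ be its monogenic extension, and let $g\in L^2(\mathbb{R}^2)$ be real-valued. Then for every $a>0$ and $\mathbf{b}\in\mathbb{R}^2$, the magnitude $|w^{(+)}_\psi((a,\theta,\mathbf{b});g)|$ does not depend on $\theta\in[0,2\pi)$.
   Context: $\mathbb{H}$: quaternions with units $\mathbf{i},\mathbf{j},\mathbf{k}$, $\mathbf{i}^2=\mathbf{j}^2=\mathbf{k}^2=\mathbf{i}\mathbf{j}\mathbf{k}=-1$, conjugation $q\mapsto q^*$. $\mathbf{r}_\theta=\begin{pmatrix}\cos\theta&-\sin\theta\\ \sin\theta&\cos\theta\end{pmatrix}$. Riesz transforms $\mathcal{R}_l$, $l=1,2$: Fourier multipliers $-\mathbf{j}f_l/|\mathbf{f}|$ for the Fourier transform $\int_{\mathbb{R}^2}h(\mathbf{x})e^{-2\pi\mathbf{j}\mathbf{f}^T\mathbf{x}}d^2\mathbf{x}$. Admissible: $\int|\psi^{(r)}|^2=1$ and $0<(2\pi)^2\int|\Psi^{(r)}(\mathbf{f})|^2/|\mathbf{f}|^2d^2\mathbf{f}<\infty$. Monogenic extension: $\psi^{(+)}=\psi^{(r)}+\mathbf{i}\mathcal{R}_1\psi^{(r)}+\mathbf{j}\mathcal{R}_2\psi^{(r)}$. For $\boldsymbol{\xi}=(a,\theta,\mathbf{b})$, $\psi^{(+)}_{\boldsymbol{\xi}}(\mathbf{x})=\frac1a\psi^{(+)}(\mathbf{r}_{-\theta}(\mathbf{x}-\mathbf{b})/a)$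 and $w^{(+)}_\psi(\boldsymbol{\xi};g)=\int_{\mathbb{R}^2}g(\mathbf{x})[\psi^{(+)}_{\boldsymbol{\xi}}(\mathbf{x})]^*d^2\mathbf{x}$. *)

(* Defs.v *)
From HB Require Import structures.
From mathcomp Require Import all_boot all_order all_algebra.
From mathcomp Require Import ring.
From mathcomp Require Import all_classical all_reals all_analysis.
Import Order.TTheory GRing.Theory Num.Theory.
Import numFieldNormedType.Exports.

Set Implicit Arguments.
Unset Strict Implicit.
Unset Printing Implicit Defensive.

Local Open Scope classical_set_scope.
Local Open Scope ring_scope.

(* [Quat a b c d] is a + b i + c j + d k. *)
Record quat (R : Type) := Quat { qre : R; qim_i : R; qim_j : R; qim_k : R }.
Arguments qre {R}.
Arguments qim_i {R}.
Arguments qim_j {R}.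
Arguments qim_k {R}.

Section QuatRing.
Variable R : realType.
Implicit Types p q r : quat R.

Definition tuple_of_quat q := (qre q, qim_i q, qim_j q, qim_k q).
Definition quat_of_tuple (t : R * R * R * R) :=
  let: (a, b, c, d) := t in Quat a b c d.
Lemma tuple_of_quatK : cancel tuple_of_quat quat_of_tuple.
Proof. by case. Qed.

HB.instance Definition _ := Choice.copy (quat R) (can_type tuple_of_quatK).

Definition quat_add p q :=
  Quat (qre p + qre q) (qim_i p + qim_i q) (qim_j p + qim_j q)
    (qim_k p + qim_k q).
Definition quat_opp q := Quat (- qre q) (- qim_i q) (- qim_j q) (- qim_k q).

Definition quat_mul p q :=
  let: Quat a b c d := p in let: Quat a' b' c' d' := q in
  Quat (a * a' - b * b' - c * c' - d * d')
       (a * b' + b * a' + c * d' - d * c')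
       (a * c' - b * d' + c * a' + d * b')
       (a * d' + b * c' - c * b' + d * a').

Fact quat_addA : associative quat_add.
Proof. by case=> ????[]????[]????; rewrite /quat_add/= !addrA. Qed.
Fact quat_addC : commutative quat_add.
Proof. by case=> a b c d []a' b' c' d'; congr Quat => /=; rewrite addrC. Qed.
Fact quat_add0 : left_id (Quat 0 0 0 0) quat_add.
Proof. by case=> ????; rewrite /quat_add/= !add0r. Qed.
Fact quat_addN : left_inverse (Quat 0 0 0 0) quat_opp quat_add.
Proof. by case=> ????; rewrite /quat_add/= !addNr. Qed.

HB.instance Definition _ :=
  GRing.isZmodule.Build (quat R) quat_addA quat_addC quat_add0 quat_addN.

Fact quat_mulA : associative quat_mul.
Proof. by case=> ????[]????[]????; congr Quat; ring. Qed.
Fact quat_mul1l : left_id (Quat 1 0 0 0) quat_mul.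
Proof. by case=> ????; congr Quat; ring. Qed.
Fact quat_mul1r : right_id (Quat 1 0 0 0) quat_mul.
Proof. by case=> ????; congr Quat; ring. Qed.
Fact quat_mulDl : left_distributive quat_mul quat_add.
Proof. by case=> ????[]????[]????; congr Quat => /=; ring. Qed.
Fact quat_mulDr : right_distributive quat_mul quat_add.
Proof. by case=> ????[]????[]????; congr Quat => /=; ring. Qed.
Fact quat_1_neq0 : Quat 1 0 0 0 != 0 :> quat R.
Proof. by apply/eqP => -[] /eqP; rewrite oner_eq0. Qed.

HB.instance Definition _ :=
  GRing.Zmodule_isNzRing.Build (quat R) quat_mulA quat_mul1l quat_mul1r quat_mulDl quat_mulDr
    quat_1_neq0.

Definition quat_of_real (x : R) : quat R := Quat x 0 0 0.
Definition qI : quat R := Quat 0 1 0 0.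
Definition qJ : quat R := Quat 0 0 1 0.
Definition qK : quat R := Quat 0 0 0 1.

Lemma quat_relations :
  [/\ qI * qI = -1, qJ * qJ = -1, qK * qK = -1 & qI * qJ * qK = -1].
Proof. by split; congr Quat => /=; ring. Qed.

Definition quat_conj q : quat R := Quat (qre q) (- qim_i q) (- qim_j q) (- qim_k q).
Definition quat_norm q : R :=
  Num.sqrt (qre q ^+ 2 + qim_i q ^+ 2 + qim_j q ^+ 2 + qim_k q ^+ 2).

Lemma quat_mul_conj q : q * quat_conj q = quat_of_real (quat_norm q ^+ 2).
Proof.
case: q => a b c d; rewrite /quat_norm sqr_sqrtr; last by rewrite !addr_ge0 ?sqr_ge0.
by congr Quat => /=; ring.
Qed.

(* The exponential e^{t j}. *)
Definition quat_expJ (t : R) : quat R := Quat (cos t) 0 (sin t) 0.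

End QuatRing.

Section Plane.
Variable R : realType.
Local Notation R2 := (R * R)%type.
Implicit Types (x f : R2) (l : 'I_2).

Definition leb2 :
    {measure set (measurableTypeR R * measurableTypeR R)%type -> \bar R} :=
  (@lebesgue_measure R \x @lebesgue_measure R)%E.

Definition coord2 l x : R := if l == 0 then x.1 else x.2.
Definition dot2 f x : R := f.1 * x.1 + f.2 * x.2.
Definition norm2 x : R := Num.sqrt (x.1 ^+ 2 + x.2 ^+ 2).

Definition rot2 (t : R) x : R2 :=
  (cos t * x.1 - sin t * x.2, sin t * x.1 + cos t * x.2).

Definition qintegral (h : R2 -> quat R) : quat R :=
  Quat (\int[leb2]_x qre (h x)) (\int[leb2]_x qim_i (h x))
       (\int[leb2]_x qim_j (h x)) (\int[leb2]_x qim_k (h x)).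

Definition fourier1 (h : R2 -> R) (f : R2) : quat R :=
  qintegral (fun x => quat_of_real (h x) * quat_expJ (- (2 * pi * dot2 f x))).

Definition qL2 (H : R2 -> quat R) : Prop :=
  [/\ qre \o H \in Lfun leb2 2%:E, qim_i \o H \in Lfun leb2 2%:E,
      qim_j \o H \in Lfun leb2 2%:E & qim_k \o H \in Lfun leb2 2%:E].

(* [H] is (a version of) the Fourier-Plancherel transform of the real-valued
   [h] in L^2: (h, H) is in the L^2 closure of the graph of [fourier1] on the
   intersection of L^1 and L^2. *)
Definition is_fourier (h : R2 -> R) (H : R2 -> quat R) : Prop :=
  [/\ h \in Lfun leb2 2%:E, qL2 H &
  exists u : nat -> R2 -> R,
    [/\ forall n, u n \in Lfun leb2 1%:E /\ u n \in Lfun leb2 2%:E,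
        (\int[leb2]_x ((u n x - h x) ^+ 2)%:E @[n --> \oo] --> 0)%E &
        (\int[leb2]_f (quat_norm (fourier1 (u n) f - H f) ^+ 2)%:E
           @[n --> \oo] --> 0)%E]].

(* The index [l : 'I_2] is 0-based. The value of the multiplier at the null
   frequency, where it is undefined, is irrelevant. *)
Definition riesz_multiplier l f : quat R :=
  - qJ R * quat_of_real (coord2 l f / norm2 f).

(* [r] is (a version of) the l-th Riesz transform of [h], as an operator on
   real-valued square-integrable functions. *)
Definition is_riesz l (h r : R2 -> R) : Prop :=
  exists2 H, is_fourier h H &
    is_fourier r (fun f => riesz_multiplier l f * H f).

Definition admissible (psi : R2 -> R) : Prop :=
  [/\ psi \in Lfun leb2 2%:E,
      (\int[leb2]_x (`|psi x| ^+ 2)%:E = 1)%E &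
  exists2 Psi, is_fourier psi Psi &
    (0 < ((2 * pi) ^+ 2)%:E *
         \int[leb2]_f (quat_norm (Psi f) ^+ 2 / norm2 f ^+ 2)%:E < +oo)%E].

(* The profile is required almost everywhere, as befits an L^2 class. *)
Definition isotropic (psi : R2 -> R) : Prop :=
  exists rho : R -> R, {ae leb2, forall x, psi x = rho (norm2 x)}.

Definition is_monogenic_extension (psi : R2 -> R) (psip : R2 -> quat R) : Prop :=
  exists r1 r2 : R2 -> R,
    [/\ is_riesz 0 psi r1, is_riesz 1 psi r2 &
        forall x, psip x = quat_of_real (psi x) + qI R * quat_of_real (r1 x)
                           + qJ R * quat_of_real (r2 x)].

Definition wavelet (psip : R2 -> quat R) (a t : R) (b : R2) (x : R2) : quat R :=
  quat_of_real a^-1 *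
    psip (rot2 (- t) ((x.1 - b.1) / a, (x.2 - b.2) / a)).

Definition cwt (psip : R2 -> quat R) (g : R2 -> R) (a t : R) (b : R2) : quat R :=
  qintegral (fun x => quat_of_real (g x) * quat_conj (wavelet psip a t b x)).

End Plane.

(* Main.v *)
Require Import Defs.
From HB Require Import structures.
From mathcomp Require Import all_boot all_order all_algebra.
From mathcomp Require Import ring lra.
From mathcomp Require Import all_classical all_reals all_analysis.
From mathcomp Require Import measurable_realfun.
Import Order.TTheory GRing.Theory Num.Theory.
Import numFieldNormedType.Exports.

Set Implicit Arguments.
Unset Strict Implicit.
Unset Printing Implicit Defensive.

Local Open Scope classical_set_scope.
Local Open Scope ring_scope.

(** The Riesz transforms [r1], [r2] of an isotropic function are steerable: for a
    rotation [rho] of angle [t], [r1 \o rho = cos t * r1 - sin t * r2] and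
    [r2 \o rho = sin t * r1 + cos t * r2] almost everywhere ([riesz_steer]).
    Indeed the Fourier transform commutes with rotations ([L2ft_rot]), the
    transform of an isotropic function is itself isotropic, and the multipliers
    [f_l / |f|] rotate like the vector [f]. Pairing with a real [g], the
    components of the wavelet coefficient along [i] and [j] thus rotate with the
    angle while the real one is constant, so that the magnitude is constant.

    The argument needs two facts on the Fourier-Plancherel transform, which is
    defined as the closure in L^2 of the Fourier integral on the intersection of
    L^1 and L^2: it is single-valued ([L2ft_unique]), and it is injective
    ([L2ft_injective]). Both come from the duality
    [\int (F u) v = \int u (F v)] ([ct_duality], [st_duality]) applied to one
    family of functions [v], the modulations of the kernel
    [kern a x = (1 - cos (2 pi a x)) / x ^ 2] (in each variable). Its transform is
    a multiple of the tent of half-width [a] ([Rintegral_cos_kern]), where the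
    constant, the integral of [kern 1], only matters by being positive: the
    formula follows from the scaling identity [\int kern a = |a| \int kern 1].

    A function with a null transform is hence orthogonal to all the tents, so to
    the indicators of open rectangles, which are limits of differences of tents,
    and it vanishes almost everywhere by a Dynkin argument: this is injectivity.
    If [A] is a transform of the null function then the duality says that the
    products of [A] by the kernels, which are integrable, have null transforms;
    they vanish by injectivity, hence [A] does too: this is single-valuedness.

    Rotations preserve the planar Lebesgue measure because they are composites of
    shears ([leb2_rotation]). *)

(** * Negligible sets and maps that scale a measure *)

Section almost_everywhere.
Context d (X : measurableType d) (R : realType).
Variable m : {measure set X -> \bar R}.

Lemma ae_imply (P Q : X -> Prop) : (forall x, P x -> Q x) ->
  {ae m, forall x, P x} -> {ae m, forall x, Q x}.
Proof. by move=> PQ; apply: filterS. Qed.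

Lemma ae_imply2 (P Q S : X -> Prop) : (forall x, P x -> Q x -> S x) ->
  {ae m, forall x, P x} -> {ae m, forall x, Q x} -> {ae m, forall x, S x}.
Proof. by move=> PQS HP HQ; apply: filterS2 HP HQ. Qed.

End almost_everywhere.

Section scaling_maps.
Context d (X : measurableType d) (R : realType).
Variable mu : {measure set X -> \bar R}.

(** [scales k T]: the change of variables [T] multiplies integrals by [k], that is,
    the image measure of [mu] by [T] is [k] times [mu]. *)
Definition scales (k : R) (T : X -> X) : Prop :=
  [/\ 0 < k, measurable_fun setT T &
  forall f : X -> \bar R, measurable_fun setT f -> (forall x, 0 <= f x)%E ->
    (\int[mu]_x f (T x) = k%:E * \int[mu]_x f x)%E].

Lemma eq_scales k (S T : X -> X) : S =1 T -> scales k S -> scales k T.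
Proof. by move=> /funext ->. Qed.

Lemma scales_comp k l S T :
  scales k S -> scales l T -> scales (k * l) (S \o T).
Proof.
move=> [k0 mS HS] [l0 mT HT]; split; first exact: mulr_gt0.
  exact: measurableT_comp.
move=> f mf f0 /=.
rewrite (HT (fun x => f (S x))) ?HS //; last exact: measurableT_comp.
by rewrite muleA -EFinM mulrC.
Qed.

Lemma scales_ae k T (P : set X) : scales k T ->
  {ae mu, forall x, P x} -> {ae mu, forall x, P (T x)}.
Proof.
move=> [k0 mT HT] [N [mN N0 PN]]; exists (T @^-1` N); split.
- by rewrite -[_ @^-1` _]setTI; exact: mT.
- have mTN : measurable (T @^-1` N) by rewrite -[X in measurable X]setTI; exact: mT.
  rewrite -(setIT (T @^-1` N)) -integral_indic//.
  rewrite (HT (fun x => (\1_N x)%:E)).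
  + by rewrite integral_indic// setIT N0 mule0.
  + exact/measurable_EFinP.
  + by move=> x; rewrite lee_fin.
- by move=> x /= nP; exact: PN.
Qed.

Lemma scales_integral T (f : X -> \bar R) : scales 1 T ->
  measurable_fun setT f -> (\int[mu]_x f (T x) = \int[mu]_x f x)%E.
Proof.
move=> [_ mT HT] mf; rewrite integralE [RHS]integralE; congr (_ - _)%E.
  rewrite -[RHS]mul1e -(HT f^\+%E)//; last exact: measurable_funepos.
  by apply: eq_integral => x _; rewrite !funeposE.
rewrite -[RHS]mul1e -(HT f^\-%E)//; last exact: measurable_funeneg.
by apply: eq_integral => x _; rewrite !funenegE.
Qed.

Lemma scales_integrable k T (f : X -> \bar R) : scales k T ->
  mu.-integrable setT f -> mu.-integrable setT (f \o T).
Proof.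
move=> [k0 mT HT] /integrableP[mf foo]; apply/integrableP; split.
  exact: measurableT_comp.
rewrite (HT (fun x => `|f x|)%E)//; last exact: measurableT_comp.
by rewrite lte_mul_pinfty// ?lee_fin ?(ltW k0)//; exact: integral_ge0.
Qed.

End scaling_maps.

Section line.
Context (R : realType).
Notation mu := (@lebesgue_measure R).

Lemma lebesgue_affine (a b : R) : 0 < a ->
  scales mu a^-1 (fun x : measurableTypeR R => a * x + b : measurableTypeR R).
Proof.
move=> a0; have mT : measurable_fun setT
    (fun x : measurableTypeR R => a * x + b : measurableTypeR R).
  by apply: measurable_funD => //; exact: measurable_funM.
split; rewrite ?invr_gt0// => f mf f0.
have a0' : (0 <= a^-1) by rewrite invr_ge0 ltW.
have E (A : set (measurableTypeR R)) : measurable A -> pushforward mu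
    (fun x : measurableTypeR R => a * x + b : measurableTypeR R) A =
    mscale (NngNum a0') mu A.
  move=> mA; rewrite /mscale/=.
  rewrite (@lebesgue_measure_unique R (mscale (NngNum (ltW a0))
    (pushforward mu (fun x : measurableTypeR R => a * x + b : measurableTypeR R))))//.
    by rewrite /mscale/= muleA -EFinM mulVf ?gt_eqF// mul1e.
  move=> _ [[u v]] _ <-.
  have E : (fun x : R => a * x + b) @^-1` `]u, v] =
      `](u - b) / a, (v - b) / a]%classic.
    apply/seteqP; split => x /=; rewrite !in_itv/= ltr_pdivrMr// ler_pdivlMr//;
      by rewrite ltrBlDr lerBrDr (mulrC a).
  change (mu `]u, v]%classic =
    (a%:E * mu ((fun x : R => (a * x + b)%R) @^-1` `]u, v]%classic))%E).
  rewrite E.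
  rewrite !lebesgue_measure_itv/= !lte_fin ltr_pM2r ?invr_gt0// ltrD2r.
  case: ifP => _; last by rewrite mule0.
  rewrite -!EFinB -EFinM; congr (_%:E).
  by field; rewrite gt_eqF.
rewrite -[LHS](@ge0_integral_pushforward _ _ _ _ _ _ mT mu setT f)//.
transitivity (\int[mscale (NngNum a0') mu]_y f y)%E.
  by apply: eq_measure_integral => A mA _; apply: E.
by rewrite ge0_integral_mscale.
Qed.

Lemma lebesgue_reflection :
  scales mu 1 (-%R : measurableTypeR R -> measurableTypeR R).
Proof.
have mN : measurable_fun setT (-%R : measurableTypeR R -> measurableTypeR R) by [].
split => // f mf f0; rewrite mul1e.
rewrite -[LHS](@ge0_integral_pushforward _ _ _ _ _ _ mN mu setT f)//.
by apply: eq_measure_integral => A mA _; exact: lebesgue_measureN.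
Qed.

End line.

(** * Affine changes of variables in the plane *)

Section plane_maps.
Context (R : realType).
Notation mu := (@lebesgue_measure R).
Notation leb := (leb2 R).
Notation R2 := (measurableTypeR R * measurableTypeR R)%type.

Lemma leb2_sigma_finite : sigma_finite setT (leb2 R).
Proof.
have /sigma_finiteP[F [TF ndF Foo]] := sigma_finiteT mu.
exists (fun n => F n `*` F n).
  rewrite -setXTT TF predeqE => -[x y]; split.
    move=> [/= [n _ Fnx] [k _ Gky]]; exists (maxn n k) => //; split.
    - by move: x Fnx; exact/subsetPset/ndF/leq_maxl.
    - by move: y Gky; exact/subsetPset/ndF/leq_maxr.
  by move=> [n _ []/= ? ?]; split; exists n.
move=> k; have [? ?] := Foo k.
split; first exact: measurableX.
by rewrite /leb2/= product_measure1E// lte_mul_pinfty// ge0_fin_numE.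
Qed.

(** The measure [leb2] bundled with its sigma-finiteness, as needed by the theorems
    of Fubini and Tonelli on the product of the plane with itself. *)
Definition leb2_sf : {sigma_finite_measure set R2 -> \bar R} :=
  HB.pack (Measure.sort leb) (Measure.class leb)
    (Measure_isSigmaFinite.Build _ _ _ leb leb2_sigma_finite).

Lemma leb2_tonelli1 (f : R2 -> \bar R) : measurable_fun setT f ->
  (forall x, 0 <= f x)%E ->
  (\int[leb]_x f x = \int[mu]_x \int[mu]_y f (x, y))%E.
Proof. by move=> mf f0; exact: fubini_tonelli1. Qed.

Lemma leb2_tonelli2 (f : R2 -> \bar R) : measurable_fun setT f ->
  (forall x, 0 <= f x)%E ->
  (\int[leb]_x f x = \int[mu]_y \int[mu]_x f (x, y))%E.
Proof. by move=> mf f0; exact: fubini_tonelli2. Qed.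

Lemma measurable_pair (f g : R2 -> R) :
  measurable_fun setT f -> measurable_fun setT g ->
  measurable_fun setT (fun x : R2 => (f x, g x) : R2).
Proof. by move=> mf mg; exact: measurable_fun_pair. Qed.

Lemma leb2_shear1 (s : R) :
  scales leb 1 (fun x : R2 => (x.1 + s * x.2, x.2) : R2).
Proof.
have mT : measurable_fun setT (fun x : R2 => (x.1 + s * x.2, x.2) : R2).
  apply: measurable_pair => //; apply: measurable_funD => //.
  exact: measurable_funM.
split => // f mf f0; rewrite mul1e [RHS]leb2_tonelli2//.
transitivity (\int[mu]_y \int[mu]_x f (x + s * y, y)%R)%E.
  apply: (@leb2_tonelli2 (fun x => f (x.1 + s * x.2, x.2))) => [|x]; last exact: f0.
  exact: measurableT_comp mf mT.
apply: eq_integral => y _.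
have [_ _] := @lebesgue_affine R 1 (s * y) ltr01.
move=> /(_ (fun x => f (x, y))).
rewrite invr1 mul1e => <-//; first by under eq_integral do rewrite mul1r.
exact: measurableT_comp mf _.
Qed.

Lemma leb2_shear2 (s : R) :
  scales leb 1 (fun x : R2 => (x.1, s * x.1 + x.2) : R2).
Proof.
have mT : measurable_fun setT (fun x : R2 => (x.1, s * x.1 + x.2) : R2).
  apply: measurable_pair => //; apply: measurable_funD => //.
  exact: measurable_funM.
split => // f mf f0; rewrite mul1e [RHS]leb2_tonelli1//.
transitivity (\int[mu]_x \int[mu]_y f (x, s * x + y)%R)%E.
  apply: (@leb2_tonelli1 (fun x => f (x.1, s * x.1 + x.2))) => [|x]; last exact: f0.
  exact: measurableT_comp mf mT.
apply: eq_integral => x _.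
have [_ _] := @lebesgue_affine R 1 (s * x) ltr01.
move=> /(_ (fun y => f (x, y))).
rewrite invr1 mul1e => <-//.
  by under eq_integral do rewrite mul1r addrC.
exact: measurableT_comp mf _.
Qed.

Lemma leb2_affine (a : R) (b : R * R) : 0 < a ->
  scales leb (a^-1 * a^-1) (fun x : R2 => (a * x.1 + b.1, a * x.2 + b.2) : R2).
Proof.
move=> a0.
have mT : measurable_fun setT
    (fun x : R2 => (a * x.1 + b.1, a * x.2 + b.2) : R2).
  by apply: measurable_pair => //; apply: measurable_funD => //;
    exact: measurable_funM.
split => //; first by rewrite mulr_gt0// invr_gt0.
move=> f mf f0.
transitivity (\int[mu]_x \int[mu]_y f (a * x + b.1, a * y + b.2)%R)%E.
  apply: (@leb2_tonelli1 (fun x => f (a * x.1 + b.1, a * x.2 + b.2))) => [|x];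
    last exact: f0.
  exact: measurableT_comp mf mT.
have [_ m1 H1] := @lebesgue_affine R a b.1 a0.
have [_ _ H2] := @lebesgue_affine R a b.2 a0.
have mF := measurable_fun_fubini_tonelli_F (m2 := mu) f mf f0.
have F0 x : (0 <= fubini_F mu f x)%E by exact: integral_ge0.
transitivity (\int[mu]_x (a^-1%:E * fubini_F mu f (a * x + b.1)%R))%E.
  apply: eq_integral => x _.
  by rewrite (H2 (fun y => f (a * x + b.1, y)))//; exact: measurableT_comp mf _.
rewrite ge0_integralZl//=; last 2 first.
- exact: measurableT_comp mF m1.
- by rewrite lee_fin invr_ge0 ltW.
by rewrite (H1 (fubini_F mu f))// muleA EFinM [in RHS]leb2_tonelli1.
Qed.

(** A rotation is a composite of three shears, unless it is the half-turn, which
    is the square of a quarter-turn. *)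
Lemma leb2_rotation (c s : R) : c ^+ 2 + s ^+ 2 = 1 ->
  scales leb 1 (fun x : R2 => (c * x.1 - s * x.2, s * x.1 + c * x.2) : R2).
Proof.
wlog c1 : c s / c != -1 => [hwlog|] cs1.
  have [cN1|/hwlog] := eqVneq c (-1); last exact.
  have s0 : s = 0.
    by apply/eqP; rewrite -sqrf_eq0 -(addKr (c ^+ 2) (s ^+ 2)) cs1 cN1; apply/eqP; ring.
  have H : scales leb 1 (fun x : R2 => (0 * x.1 - 1 * x.2, 1 * x.1 + 0 * x.2) : R2).
    by apply: hwlog; [rewrite eq_sym oppr_eq0 oner_eq0|ring].
  have := scales_comp H H; rewrite mulr1; apply: eq_scales.
  by case=> x y /=; rewrite s0 cN1; congr pair; ring.
have c1' : 1 + c != 0 by rewrite addrC addr_eq0.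
have s2 : s ^+ 2 = (1 + c) * (1 - c) by rewrite -(addKr (c ^+ 2) (s ^+ 2)) cs1; ring.
have H := scales_comp (leb2_shear1 (- (s / (1 + c))))
  (scales_comp (leb2_shear2 s) (leb2_shear1 (- (s / (1 + c))))).
rewrite !mulr1 in H.
apply: eq_scales H => -[x y] /=.
have E : 1 - s / (1 + c) * s = c.
  rewrite mulrAC -expr2 s2 mulrAC divff// mul1r; ring.
congr pair; last by rewrite -[c in RHS]E; ring.
set t := s / (1 + c) in E *.
have Es : t * (1 + c) = s by rewrite /t; field.
have -> : c * x - s * y = (1 - t * s) * x - t * (1 + (1 - t * s)) * y.
  by rewrite E Es.
ring.
Qed.

End plane_maps.

(** * Square-integrable functions *)

Section square_integrable.
Context d (X : measurableType d) (R : realType).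
Variable mu : {measure set X -> \bar R}.
Implicit Types f g h k : X -> R.

(** Square-integrability. *)
Definition sqint h : Prop :=
  measurable_fun setT h /\ (\int[mu]_x ((h x) ^+ 2)%:E < +oo)%E.

Lemma sqintP h : sqint h <->
  measurable_fun setT h /\ mu.-integrable setT (fun x => ((h x) ^+ 2)%:E).
Proof.
split=> -[mh H]; split => //.
  apply/integrableP; split; first exact/measurable_EFinP/measurable_funX.
  by under eq_integral do rewrite /= ger0_norm ?sqr_ge0//.
case/integrableP : H => _.
by under eq_integral do rewrite /= ger0_norm ?sqr_ge0//.
Qed.

Lemma Lfun2_sqint h : h \in Lfun mu 2%:E -> sqint h.
Proof.
move=> h2; apply/sqintP; split; last exact: Lfun2_integrable_sqr.
by move: h2; rewrite inE => /andP[]; rewrite inE.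
Qed.

Lemma sqint_le (C : R) f g : measurable_fun setT f -> sqint g ->
  (forall x, `|f x| <= C * `|g x|) -> sqint f.
Proof.
move=> mf /sqintP[mg ig] fg; apply/sqintP; split => //.
apply: (le_integrable measurableT _ _ (integrableZl measurableT (C ^+ 2) ig)).
  exact/measurable_EFinP/measurable_funX.
move=> x _ /=; rewrite lee_fin -exprMn !ger0_norm ?sqr_ge0//.
rewrite -(real_normK (num_real (f x))) -(real_normK (num_real (_ * _))).
rewrite lerXn2r ?nnegrE// (le_trans (fg x))// normrM.
by rewrite ler_wpM2r// ler_norm.
Qed.

Lemma sqint_comb a b f g : sqint f -> sqint g ->
  sqint (fun x => a * f x + b * g x).
Proof.
move=> /sqintP[mf If] /sqintP[mg ig]; apply/sqintP.
have m : measurable_fun setT (fun x => a * f x + b * g x).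
  by apply: measurable_funD; exact: measurable_funM.
split => //.
apply: (le_integrable measurableT _ _ (integrableD measurableT
  (integrableZl measurableT (2 * a ^+ 2) If)
  (integrableZl measurableT (2 * b ^+ 2) ig))).
  exact/measurable_EFinP/measurable_funX.
move=> x _ /=; rewrite lee_fin !ger0_norm ?sqr_ge0//; last first.
  by apply: addr_ge0; apply: mulr_ge0; rewrite ?sqr_ge0// mulr_ge0 ?sqr_ge0.
rewrite -subr_ge0.
by rewrite [X in 0 <= X](_ : _ = (a * f x - b * g x) ^+ 2) ?sqr_ge0//; ring.
Qed.

Lemma sqint_mul f g : sqint f -> sqint g ->
  mu.-integrable setT (fun x => (f x * g x)%:E).
Proof.
move=> /sqintP[mf If] /sqintP[mg ig].
apply: (le_integrable measurableT _ _ (integrableD measurableT If ig)).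
  exact/measurable_EFinP/measurable_funM.
move=> x _ /=; rewrite lee_fin normrM [leRHS]ger0_norm ?addr_ge0 ?sqr_ge0//.
rewrite -(real_normK (num_real (f x))) -(real_normK (num_real (g x))).
have := sqr_ge0 (`|f x| - `|g x|).
have := mulr_ge0 (normr_ge0 (f x)) (normr_ge0 (g x)).
nra.
Qed.

(** A weighted arithmetic-geometric form of the Cauchy-Schwarz inequality. *)
Lemma sqint_mul_bound (e : R) f k : 0 < e -> sqint f -> sqint k ->
  `|\int[mu]_x (f x * k x)| <=
  e^-1 * \int[mu]_x ((f x) ^+ 2) + e * \int[mu]_x ((k x) ^+ 2).
Proof.
move=> e0 sf sk.
have /sqintP[mf If] := sf; have /sqintP[mk ik] := sk.
have ifk := sqint_mul sf sk.
apply: (le_trans (le_normr_Rintegral measurableT ifk)).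
rewrite -RintegralZl// -RintegralZl// -RintegralD//; last 2 first.
- exact: (integrableZl measurableT (e^-1) If).
- exact: (integrableZl measurableT e ik).
apply: le_Rintegral => //.
- exact: (integrable_norm ifk).
- by apply: (integrableD measurableT (integrableZl measurableT (e^-1) If)
    (integrableZl measurableT e ik)).
move=> x _; rewrite normrM -(ler_pM2l e0) mulrDr (mulrA e e^-1) divff ?gt_eqF// mul1r.
rewrite -(real_normK (num_real (f x))) -(real_normK (num_real (k x))).
have := sqr_ge0 (`|f x| - e * `|k x|).
have := mulr_ge0 (ltW e0) (mulr_ge0 (normr_ge0 (f x)) (normr_ge0 (k x))).
nra.
Qed.

(** Convergence in L^2; the differences [u n - h] need only be square-integrable for
    large [n]. *)
Definition l2cvg (u : nat -> X -> R) h : Prop :=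
  (\int[mu]_x ((u n x - h x) ^+ 2)%:E @[n --> \oo] --> 0)%E.

Lemma l2cvg_near (u : nat -> X -> R) h (e : R) : 0 < e -> l2cvg u h ->
  \forall n \near \oo, (\int[mu]_x ((u n x - h x) ^+ 2)%:E < e%:E)%E.
Proof.
move=> e0 /fine_cvgP[fin_u cvg_u].
have lt_u := cvgr_lt _ cvg_u _ e0.
near=> n.
have fn : (\int[mu]_x ((u n x - h x) ^+ 2)%:E)%E \is a fin_num by near: n.
rewrite -(fineK fn) lte_fin; near: n; exact: lt_u.
Unshelve. all: by end_near.
Qed.

(** Convergence in L^2 implies weak convergence. *)
Lemma l2cvg_weak (u : nat -> X -> R) h k :
  (forall n, measurable_fun setT (u n)) -> sqint h -> sqint k -> l2cvg u h ->
  \int[mu]_x (u n x * k x) @[n --> \oo] --> \int[mu]_x (h x * k x).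
Proof.
move=> mu_ sh sk uh; apply/cvgrPdist_le => eps eps0.
pose K := \int[mu]_x ((k x) ^+ 2).
have K0 : 0 <= K by apply: Rintegral_ge0 => x _; exact: sqr_ge0.
(* With this weight the two terms of [sqint_mul_bound] are at most [eps / 2]. *)
pose e := eps / 2 / (K + 1).
have e0 : 0 < e by rewrite !divr_gt0// ltr_wpDl.
have := l2cvg_near (mulr_gt0 e0 (divr_gt0 eps0 (ltr0n R 2))) uh.
apply: filterS => n Hn.
have mh : measurable_fun setT h by case: sh.
have sd : sqint (fun x => u n x - h x).
  split; first exact: measurable_funB.
  by apply: (lt_trans Hn); rewrite ltry.
have su : sqint (u n).
  have := sqint_comb 1 1 sd sh; congr sqint; apply/funext => x; ring.
rewrite distrC -RintegralB//; [|exact: sqint_mul|exact: sqint_mul].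
under eq_Rintegral do rewrite -mulrBl.
apply: (le_trans (sqint_mul_bound e0 sd sk)).
rewrite [leRHS]splitr lerD//; last first.
  rewrite -/K /e mulrAC ler_pdivrMr ?ltr_wpDl// ler_pM2l ?divr_gt0//.
  by rewrite lerDl.
rewrite ler_pdivrMl//.
have := ltW Hn; rewrite -(@fineK _ (\int[mu]_x _)%E) ?lee_fin//.
by rewrite ge0_fin_numE ?(lt_trans Hn) ?ltry//; apply: integral_ge0 => x _;
  rewrite lee_fin sqr_ge0.
Qed.

Lemma l2cvg_comb a b (u v : nat -> X -> R) h k :
  (forall n, measurable_fun setT (u n)) -> (forall n, measurable_fun setT (v n)) ->
  measurable_fun setT h -> measurable_fun setT k ->
  l2cvg u h -> l2cvg v k ->
  l2cvg (fun n x => a * u n x + b * v n x) (fun x => a * h x + b * k x).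
Proof.
move=> mu_ mv mh mk uh vk; rewrite /l2cvg.
have mD (w : nat -> X -> R) g n : measurable_fun setT (w n) -> measurable_fun setT g ->
    measurable_fun setT (fun x => ((w n x - g x) ^+ 2)%:E).
  by move=> mw mg; apply/measurable_EFinP/measurable_funX; exact: measurable_funB.
have G0 (w : nat -> X -> R) g n x : setT x -> (0 <= ((w n x - g x) ^+ 2)%:E)%E.
  by rewrite lee_fin sqr_ge0.
apply: (@squeeze_cvge _ _ _ _ (cst 0%E) _ (fun n =>
  (2 * a ^+ 2)%:E * \int[mu]_x ((u n x - h x) ^+ 2)%:E +
  (2 * b ^+ 2)%:E * \int[mu]_x ((v n x - k x) ^+ 2)%:E)%E); last 2 first.
- exact: cvg_cst.
- rewrite -[X in _ --> X](_ : ((2 * a ^+ 2)%:E * 0 + (2 * b ^+ 2)%:E * 0 = 0)%E);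
    last by rewrite !mule0 adde0.
  by apply: cvgeD; [rewrite !mule0|exact: (cvgeZl _ uh)|exact: (cvgeZl _ vk)].
apply: nearW => n; rewrite integral_ge0//= => [|x _]; last by rewrite lee_fin sqr_ge0.
have c0 (c : R) : 0 <= 2 * c ^+ 2 by rewrite mulr_ge0// sqr_ge0.
rewrite -!ge0_integralZl//; [|exact: mD|by move=> x _; exact: G0 |by rewrite lee_fin
  |exact: mD|by move=> x _; exact: G0|by rewrite lee_fin].
rewrite -ge0_integralD//; last 4 first.
- by move=> x _; rewrite mule_ge0 ?lee_fin ?sqr_ge0.
- by apply: measurable_funeM; exact: mD.
- by move=> x _; rewrite mule_ge0 ?lee_fin ?sqr_ge0.
- by apply: measurable_funeM; exact: mD.
apply: ge0_le_integral => //.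
- by move=> x _; rewrite lee_fin sqr_ge0.
- apply/measurable_EFinP/measurable_funX/measurable_funB; apply: measurable_funD;
    exact: measurable_funM.
- by apply: emeasurable_funD; apply: measurable_funeM; exact: mD.
move=> x _; rewrite -!EFinM -EFinD lee_fin -subr_ge0.
rewrite [X in 0 <= X](_ : _ =
  (a * (u n x - h x) - b * (v n x - k x)) ^+ 2) ?sqr_ge0//; ring.
Qed.

Lemma l2cvg_ae (u : nat -> X -> R) h k :
  (forall n, measurable_fun setT (u n)) ->
  measurable_fun setT h -> measurable_fun setT k ->
  {ae mu, forall x, h x = k x} -> l2cvg u h -> l2cvg u k.
Proof.
move=> mu_ mh mk hk; rewrite /l2cvg.
suff -> : (fun n => \int[mu]_x ((u n x - h x) ^+ 2)%:E)%E =
  (fun n => \int[mu]_x ((u n x - k x) ^+ 2)%:E)%E by [].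
apply/funext => n; apply: ge0_ae_eq_integral => //.
- by apply/measurable_EFinP/measurable_funX; exact: measurable_funB.
- by apply/measurable_EFinP/measurable_funX; exact: measurable_funB.
- by move=> x _; rewrite lee_fin sqr_ge0.
- by move=> x _; rewrite lee_fin sqr_ge0.
by apply: filterS hk => x + _ => ->.
Qed.

Lemma sqint_ae h k : measurable_fun setT k ->
  {ae mu, forall x, h x = k x} -> sqint h -> sqint k.
Proof.
move=> mk hk [mh H]; split => //.
rewrite (ge0_ae_eq_integral (g := fun x => (h x ^+ 2)%:E))//.
- exact/measurable_EFinP/measurable_funX.
- exact/measurable_EFinP/measurable_funX.
- by move=> x _; rewrite lee_fin sqr_ge0.
- by move=> x _; rewrite lee_fin sqr_ge0.
by apply: filterS hk => x + _ => ->.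
Qed.

Lemma l2cvg_cst h : l2cvg (fun=> h) h.
Proof.
rewrite /l2cvg; under eq_fun do under eq_integral do rewrite subrr expr0n/=.
by rewrite integral0; exact: cvg_cst.
Qed.

Lemma scales_l2cvg c T (u : nat -> X -> R) h : scales mu c T ->
  (forall n, measurable_fun setT (u n)) -> measurable_fun setT h ->
  l2cvg u h -> l2cvg (fun n => u n \o T) (h \o T).
Proof.
move=> [c0 mT HT] mu_ mh uh; rewrite /l2cvg -(mule0 c%:E).
rewrite [X in X @ \oo --> _](_ : _ =
  (fun n => c%:E * \int[mu]_x ((u n x - h x) ^+ 2)%:E)%E).
  exact: cvgeZl.
apply/funext => n; rewrite -(HT (fun x => ((u n x - h x) ^+ 2)%:E))//.
- by apply/measurable_EFinP/measurable_funX; exact: measurable_funB.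
- by move=> x; rewrite lee_fin sqr_ge0.
Qed.

Lemma scales_sqint c T h : scales mu c T -> sqint h -> sqint (h \o T).
Proof.
move=> cT /sqintP[mh ih]; apply/sqintP; split.
  by case: cT => _ mT _; exact: measurableT_comp.
exact: (scales_integrable cT ih).
Qed.

End square_integrable.

(** * Cosine and sine transforms *)

Section integral_kernels.
Context d1 d2 (X : measurableType d1) (Y : measurableType d2) (R : realType).
Variables (m1 : {sigma_finite_measure set X -> \bar R})
  (m2 : {sigma_finite_measure set Y -> \bar R}).

Lemma EFin_Rintegral d (T : measurableType d) (m : {measure set T -> \bar R})
    (f : T -> R) : m.-integrable setT (EFin \o f) ->
  (\int[m]_x f x)%:E = (\int[m]_x (f x)%:E)%E.
Proof. by move=> If; rewrite /Rintegral fineK//; exact: integrable_fin_num. Qed.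

Lemma measurable_Rintegral_fst (g : X * Y -> R) : measurable_fun setT g ->
  measurable_fun setT (fun x => \int[m2]_y g (x, y)).
Proof.
move=> mg; have mgE : measurable_fun setT (EFin \o g) by exact/measurable_EFinP.
apply: (measurableT_comp (fine_measurable measurableT)) => //.
under eq_fun do rewrite integralE.
apply: emeasurable_funB.
- have := @measurable_fun_fubini_tonelli_F _ _ _ _ _ m2 (EFin \o g)^\+%E.
  rewrite /fubini_F => H.
  have := H (measurable_funepos mgE) (fun x => funepos_ge0 _ x).
  congr measurable_fun; apply/funext => x; apply: eq_integral => y _.
  by rewrite !funeposE.
- have := @measurable_fun_fubini_tonelli_F _ _ _ _ _ m2 (EFin \o g)^\-%E.
  rewrite /fubini_F => H.
  have := H (measurable_funeneg mgE) (fun x => funeneg_ge0 _ x).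
  congr measurable_fun; apply/funext => x; apply: eq_integral => y _.
  by rewrite !funenegE.
Qed.

Lemma integrable_bounded_mul d (T : measurableType d) (m : {measure set T -> \bar R})
    (k u : T -> R) : measurable_fun setT k -> (forall x, `|k x| <= 1) ->
  m.-integrable setT (EFin \o u) -> m.-integrable setT (EFin \o (k \* u)).
Proof.
move=> mk k1 iu; have mu_ : measurable_fun setT u.
  by apply/measurable_EFinP; exact: measurable_int iu.
apply: (le_integrable measurableT _ _ iu).
  exact/measurable_EFinP/measurable_funM.
by move=> x _ /=; rewrite lee_fin normrM ler_piMl.
Qed.

(** An integral operator with bounded kernel and the operator with the transposed
    kernel are dual to each other on integrable functions. *)
Lemma kernel_duality (k : X * Y -> R) (u : X -> R) (v : Y -> R) :
  measurable_fun setT k -> (forall z, `|k z| <= 1) ->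
  m1.-integrable setT (EFin \o u) -> m2.-integrable setT (EFin \o v) ->
  \int[m1]_x (u x * \int[m2]_y (k (x, y) * v y)) =
  \int[m2]_y (v y * \int[m1]_x (k (x, y) * u x)).
Proof.
move=> mk k1 iu iv.
have mu_ : measurable_fun setT u.
  by apply/measurable_EFinP; exact: measurable_int iu.
have mv : measurable_fun setT v.
  by apply/measurable_EFinP; exact: measurable_int iv.
pose f (z : X * Y) := (u z.1 * (k z * v z.2))%:E.
have mf : measurable_fun setT f.
  apply/measurable_EFinP; apply: measurable_funM.
    exact: measurableT_comp mu_ measurable_fst.
  by apply: measurable_funM => //; exact: measurableT_comp mv measurable_snd.
have ikv x : m2.-integrable setT (EFin \o (fun y => k (x, y) * v y)).
  by apply: (integrable_bounded_mul (k := fun y => k (x, y))) => //;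
    exact: measurableT_comp mk (pair1_measurable x).
have iku y : m1.-integrable setT (EFin \o (fun x => k (x, y) * u x)).
  by apply: (integrable_bounded_mul (k := fun x => k (x, y))) => //;
    exact: measurableT_comp mk (pair2_measurable y).
have If : (m1 \x m2)%E.-integrable setT f.
  apply/integrable12ltyP => //.
  apply: (@le_lt_trans _ _ (\int[m1]_x (`|u x|%:E * \int[m2]_y `|v y|%:E))%E).
    apply: ge0_le_integral => //.
    - by move=> x _; exact: integral_ge0.
    - have maf : measurable_fun setT (abse \o f) by exact: measurableT_comp.
      have := measurable_fun_fubini_tonelli_F (m2 := m2) (abse \o f) maf
        (fun=> abse_ge0 _).
      exact.
    - apply: emeasurable_funM => //; apply/measurable_EFinP.
      exact: measurableT_comp.
    - move=> x _; rewrite -ge0_integralZl//; last exact/measurable_EFinP/measurableT_comp.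
      apply: ge0_le_integral => //.
      + by apply: measurableT_comp => //; exact: measurableT_comp mf (pair1_measurable x).
      + by apply: measurable_funeM; apply/measurable_EFinP; exact: measurableT_comp.
      + move=> y _; rewrite /f/= lee_fin !normrM ler_wpM2l// ler_piMl//.
  have fv : (\int[m2]_y `|v y|%:E)%E \is a fin_num.
    rewrite ge0_fin_numE; last exact: integral_ge0.
    by case/integrableP : iv.
  rewrite -(fineK fv) ge0_integralZr//; last 2 first.
  - by apply/measurable_EFinP; exact: measurableT_comp.
  - by rewrite lee_fin fine_ge0//; exact: integral_ge0.
  rewrite lte_mul_pinfty ?ltry//; first exact: integral_ge0.
  by rewrite ge0_fin_numE; [case/integrableP : iu|exact: integral_ge0].
congr fine.
transitivity (\int[m1]_x \int[m2]_y f (x, y))%E.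
  apply: eq_integral => x _; rewrite EFinM EFin_Rintegral// -integralZl//.
  exact: ikv.
rewrite Fubini//; apply: eq_integral => y _.
rewrite EFinM EFin_Rintegral// -integralZl//; last exact: iku.
by apply: eq_integral => x _; rewrite -EFinM /f/=; congr EFin; ring.
Qed.

End integral_kernels.

Section plane_transforms.
Context (R : realType).
Notation mu := (@lebesgue_measure R).
Notation leb := (leb2 R).
Notation R2 := (measurableTypeR R * measurableTypeR R)%type.
Implicit Types (u v h : R2 -> R).

(** The phase of the plane wave of frequency [f] at [x]. *)
Definition phase (f x : R2) : R := 2 * pi * dot2 f x.

(** The cosine and sine transforms: the Fourier transform of a real function [u] is
    [ct u - j (st u)]. *)
Definition ct u (f : R2) : R := \int[leb]_x (cos (phase f x) * u x).
Definition st u (f : R2) : R := \int[leb]_x (sin (phase f x) * u x).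

Lemma phaseC f x : phase f x = phase x f.
Proof. by rewrite /phase /dot2 (mulrC f.1) (mulrC f.2). Qed.

Lemma measurable_phase : measurable_fun setT (fun z : R2 * R2 => phase z.1 z.2).
Proof.
apply: measurable_funM => //; apply: measurable_funD; apply: measurable_funM;
  apply: measurableT_comp => //.
Qed.

Lemma measurable_cos : measurable_fun setT (@cos R).
Proof. by apply: continuous_measurable_fun; exact: continuous_cos. Qed.

Lemma measurable_sin : measurable_fun setT (@sin R).
Proof. by apply: continuous_measurable_fun; exact: continuous_sin. Qed.

Lemma measurable_cos_phase f : measurable_fun setT (fun x => cos (phase f x)).
Proof.
apply: (measurableT_comp measurable_cos).
exact: measurableT_comp measurable_phase (pair1_measurable f).
Qed.

Lemma measurable_sin_phase f : measurable_fun setT (fun x => sin (phase f x)).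
Proof.
apply: (measurableT_comp measurable_sin).
exact: measurableT_comp measurable_phase (pair1_measurable f).
Qed.

Lemma measurable_ct u : measurable_fun setT u -> measurable_fun setT (ct u).
Proof.
move=> mu_; apply: (@measurable_Rintegral_fst _ _ _ _ _ (leb2_sf R)
  (fun z : R2 * R2 => cos (phase z.1 z.2) * u z.2)).
apply: measurable_funM.
  exact: measurableT_comp measurable_cos measurable_phase.
exact: measurableT_comp mu_ measurable_snd.
Qed.

Lemma measurable_st u : measurable_fun setT u -> measurable_fun setT (st u).
Proof.
move=> mu_; apply: (@measurable_Rintegral_fst _ _ _ _ _ (leb2_sf R)
  (fun z : R2 * R2 => sin (phase z.1 z.2) * u z.2)).
apply: measurable_funM.
  exact: measurableT_comp measurable_sin measurable_phase.
exact: measurableT_comp mu_ measurable_snd.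
Qed.

(** The phase is symmetric, so the cosine and sine transforms are self-dual. *)
Lemma ct_duality u v :
  leb.-integrable setT (EFin \o u) -> leb.-integrable setT (EFin \o v) ->
  \int[leb]_x (ct u x * v x) = \int[leb]_x (u x * ct v x).
Proof.
move=> iu iv.
have := @kernel_duality _ _ _ _ _ (leb2_sf R) (leb2_sf R)
  (fun z : R2 * R2 => cos (phase z.1 z.2)) u v
  (measurableT_comp measurable_cos measurable_phase) (fun=> cos_max _) iu iv.
move=> /esym; under eq_Rintegral do (rewrite mulrC; under eq_Rintegral do rewrite phaseC).
exact.
Qed.

Lemma st_duality u v :
  leb.-integrable setT (EFin \o u) -> leb.-integrable setT (EFin \o v) ->
  \int[leb]_x (st u x * v x) = \int[leb]_x (u x * st v x).
Proof.
move=> iu iv.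
have := @kernel_duality _ _ _ _ _ (leb2_sf R) (leb2_sf R)
  (fun z : R2 * R2 => sin (phase z.1 z.2)) u v
  (measurableT_comp measurable_sin measurable_phase) (fun=> sin_max _) iu iv.
move=> /esym; under eq_Rintegral do (rewrite mulrC; under eq_Rintegral do rewrite phaseC).
exact.
Qed.

Lemma integrable_cos_phase f u : leb.-integrable setT (EFin \o u) ->
  leb.-integrable setT (EFin \o (fun x => cos (phase f x) * u x)).
Proof.
apply: (integrable_bounded_mul (measurable_cos_phase f)) => x; exact: cos_max.
Qed.

Lemma integrable_sin_phase f u : leb.-integrable setT (EFin \o u) ->
  leb.-integrable setT (EFin \o (fun x => sin (phase f x) * u x)).
Proof.
apply: (integrable_bounded_mul (measurable_sin_phase f)) => x; exact: sin_max.
Qed.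

Lemma ct_comb a b u v f :
  leb.-integrable setT (EFin \o u) -> leb.-integrable setT (EFin \o v) ->
  ct (fun x => a * u x + b * v x) f = a * ct u f + b * ct v f.
Proof.
move=> /(integrable_cos_phase f) iu /(integrable_cos_phase f) iv.
rewrite /ct -RintegralZl// -RintegralZl// -RintegralD//.
- by apply: eq_Rintegral => x _; ring.
- exact: (integrableZl measurableT a iu).
- exact: (integrableZl measurableT b iv).
Qed.

Lemma st_comb a b u v f :
  leb.-integrable setT (EFin \o u) -> leb.-integrable setT (EFin \o v) ->
  st (fun x => a * u x + b * v x) f = a * st u f + b * st v f.
Proof.
move=> /(integrable_sin_phase f) iu /(integrable_sin_phase f) iv.
rewrite /st -RintegralZl// -RintegralZl// -RintegralD//.
- by apply: eq_Rintegral => x _; ring.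
- exact: (integrableZl measurableT a iu).
- exact: (integrableZl measurableT b iv).
Qed.

(** [L2ft h A B]: [A - j B] is a Fourier-Plancherel transform of the real function
    [h], where [A] and [B] are real; it is obtained as a limit in L^2 of classical
    transforms. *)
Definition L2ft h (A B : R2 -> R) : Prop :=
  [/\ sqint leb h, sqint leb A, sqint leb B & exists u : nat -> R2 -> R,
    [/\ forall n, leb.-integrable setT (EFin \o u n) /\ sqint leb (u n),
        l2cvg leb u h, l2cvg leb (fun n => ct (u n)) A &
        l2cvg leb (fun n => st (u n)) B]].

Lemma L2ft_comb a b h A B k C D : L2ft h A B -> L2ft k C D ->
  L2ft (fun x => a * h x + b * k x) (fun x => a * A x + b * C x)
    (fun x => a * B x + b * D x).
Proof.
move=> [sh sA sB [u [su uh uA uB]]] [sk sC sD [v [sv vk vC vD]]].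
split; try exact: sqint_comb.
have mu_ n : measurable_fun setT (u n) by case: (su n) => _ [].
have mv n : measurable_fun setT (v n) by case: (sv n) => _ [].
exists (fun n x => a * u n x + b * v n x); split.
- move=> n; have [iu su'] := su n; have [iv sv'] := sv n; split.
    by apply: (integrableD measurableT (integrableZl measurableT a iu)
    (integrableZl measurableT b iv)).
  exact: sqint_comb.
- by apply: l2cvg_comb => //; [case: sh|case: sk].
- have -> : (fun n => ct (fun x => a * u n x + b * v n x)) =
      (fun n x => a * ct (u n) x + b * ct (v n) x).
    by apply/funext => n; apply/funext => f; apply: ct_comb;
      [case: (su n)|case: (sv n)].
  by apply: (l2cvg_comb a b _ _ _ _ uA vC); [move=> n; exact: measurable_ct|
    move=> n; exact: measurable_ct|case: sA|case: sC].
- have -> : (fun n => st (fun x => a * u n x + b * v n x)) =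
      (fun n x => a * st (u n) x + b * st (v n) x).
    by apply/funext => n; apply/funext => f; apply: st_comb;
      [case: (su n)|case: (sv n)].
  by apply: (l2cvg_comb a b _ _ _ _ uB vD); [move=> n; exact: measurable_st|
    move=> n; exact: measurable_st|case: sB|case: sD].
Qed.

Lemma L2ft_ae h A B h' A' B' : measurable_fun setT h' ->
  measurable_fun setT A' -> measurable_fun setT B' ->
  {ae leb, forall x, h x = h' x} -> {ae leb, forall x, A x = A' x} ->
  {ae leb, forall x, B x = B' x} -> L2ft h A B -> L2ft h' A' B'.
Proof.
move=> mh mA mB hh AA BB [sh sA sB [u [su uh uA uB]]].
have mu_ n : measurable_fun setT (u n) by case: (su n) => _ [].
split; [exact: sqint_ae sh|exact: sqint_ae sA|exact: sqint_ae sB|].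
exists u; split => //.
- by apply: l2cvg_ae uh => //; case: sh.
- by apply: l2cvg_ae uA => //; [move=> n; exact: measurable_ct|case: sA].
- by apply: l2cvg_ae uB => //; [move=> n; exact: measurable_st|case: sB].
Qed.

(** The rotation of cosine [c] and sine [s]. *)
Definition rot (c s : R) (x : R2) : R2 := (c * x.1 - s * x.2, s * x.1 + c * x.2).

Lemma phase_rot c s f x : c ^+ 2 + s ^+ 2 = 1 ->
  phase (rot c s f) (rot c s x) = phase f x.
Proof.
move=> cs; rewrite /phase; congr (_ * _); rewrite /dot2 /rot/=.
transitivity ((c ^+ 2 + s ^+ 2) * (f.1 * x.1 + f.2 * x.2)); first ring.
by rewrite cs mul1r.
Qed.

Lemma L2ft_rot c s h A B : c ^+ 2 + s ^+ 2 = 1 -> L2ft h A B ->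
  L2ft (h \o rot c s) (A \o rot c s) (B \o rot c s).
Proof.
move=> cs [sh sA sB [u [su uh uA uB]]].
have S : scales leb 1 (rot c s) by exact: leb2_rotation.
have mu_ n : measurable_fun setT (u n) by case: (su n) => _ [].
split; try exact: (scales_sqint S).
exists (fun n => u n \o rot c s); split.
- move=> n; have [iu su'] := su n; split; last exact: (scales_sqint S).
  exact: (scales_integrable S iu).
- by apply: (scales_l2cvg S) => //; case: sh.
- have -> : (fun n => ct (u n \o rot c s)) = (fun n => ct (u n) \o rot c s).
    apply/funext => n; apply/funext => f; rewrite /ct/=; congr fine.
    have := scales_integral S (f := fun y => (cos (phase (rot c s f) y) * u n y)%:E).
    under eq_integral do rewrite phase_rot//.
    apply; apply/measurable_EFinP; apply: measurable_funM => //.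
    exact: measurable_cos_phase.
  by apply: (scales_l2cvg S) => //; [move=> n; exact: measurable_ct|case: sA].
- have -> : (fun n => st (u n \o rot c s)) = (fun n => st (u n) \o rot c s).
    apply/funext => n; apply/funext => f; rewrite /st/=; congr fine.
    have := scales_integral S (f := fun y => (sin (phase (rot c s f) y) * u n y)%:E).
    under eq_integral do rewrite phase_rot//.
    apply; apply/measurable_EFinP; apply: measurable_funM => //.
    exact: measurable_sin_phase.
  by apply: (scales_l2cvg S) => //; [move=> n; exact: measurable_st|case: sB].
Qed.

(** The components of the transform of a real function along [i] and [k] vanish. *)
Lemma fourier1E u f : leb.-integrable setT (EFin \o u) ->
  fourier1 u f = Quat (ct u f) 0 (- st u f) 0.
Proof.
move=> iu; have z (k : R2 -> R) : (forall x, k x = 0) -> \int[leb]_x k x = 0.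
  by move=> k0; under eq_Rintegral do rewrite k0; rewrite Rintegral_cst// mul0r.
rewrite /fourier1 /qintegral/=; congr Quat.
- by apply: eq_Rintegral => x _; rewrite cosN /phase; ring.
- by apply: z => x; ring.
- rewrite -[RHS]mulN1r /st -RintegralZl//; last exact: integrable_sin_phase.
  by apply: eq_Rintegral => x _; rewrite sinN /phase; ring.
- by apply: z => x; ring.
Qed.

Lemma is_fourier_L2ft h (H : R2 -> quat R) : is_fourier h H ->
  L2ft h (fun f => qre (H f)) (fun f => - qim_j (H f)).
Proof.
move=> [sh [s0 s1 s2 s3] [u0 [su uh uH]]].
pose u : nat -> R2 -> R := u0.
have {}sh := Lfun2_sqint sh; have {}s0 := Lfun2_sqint s0.
have {}s1 := Lfun2_sqint s1; have {}s2 := Lfun2_sqint s2.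
have {}s3 := Lfun2_sqint s3.
have iu n : leb.-integrable setT (EFin \o u n) by apply/Lfun1_integrable; case: (su n).
have su' n : sqint leb (u n) by apply: Lfun2_sqint; case: (su n).
have mu_ n : measurable_fun setT (u n) by case: (su' n).
have m0 : measurable_fun setT (fun f => qre (H f)) by case: s0.
have m1 : measurable_fun setT (fun f => qim_i (H f)) by case: s1.
have m2 : measurable_fun setT (fun f => qim_j (H f)) by case: s2.
have m3 : measurable_fun setT (fun f => qim_k (H f)) by case: s3.
have mN : measurable_fun setT (fun f => - qim_j (H f)) by exact: measurableT_comp.
have sN : sqint leb (fun f => - qim_j (H f)).
  by apply: (sqint_le (C := 1) mN s2) => x; rewrite normrN mul1r.
have uHE n f : quat_norm (fourier1 (u n) f - H f) ^+ 2 =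
    (ct (u n) f - qre (H f)) ^+ 2 + (st (u n) f - - qim_j (H f)) ^+ 2 +
    qim_i (H f) ^+ 2 + qim_k (H f) ^+ 2.
  rewrite fourier1E// /quat_norm sqr_sqrtr; last by rewrite !addr_ge0 ?sqr_ge0.
  by case: (H f) => p q r s /=; ring.
have mH n : measurable_fun setT (fun f => (quat_norm (fourier1 (u n) f - H f) ^+ 2)%:E).
  apply/measurable_EFinP; under eq_fun do rewrite uHE.
  apply: measurable_funD; last exact: measurable_funX.
  apply: measurable_funD; last exact: measurable_funX.
  apply: measurable_funD; apply: measurable_funX; apply: measurable_funB => //.
  - exact: (measurable_ct (mu_ n)).
  - exact: (measurable_st (mu_ n)).
have squeeze (K : nat -> R2 -> R) (L : R2 -> R) :
    (forall n, measurable_fun setT (K n)) -> measurable_fun setT L ->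
    (forall n f, (K n f - L f) ^+ 2 <= quat_norm (fourier1 (u n) f - H f) ^+ 2) ->
    l2cvg leb K L.
  move=> mK mL KL; rewrite /l2cvg; apply: squeeze_cvge (cvg_cst 0%E) uH.
  apply: nearW => n; rewrite integral_ge0//= => [|x _]; last by rewrite lee_fin sqr_ge0.
  apply: ge0_le_integral => //.
  - by move=> x _; rewrite lee_fin sqr_ge0.
  - by apply/measurable_EFinP/measurable_funX; exact: measurable_funB.
  - exact: mH.
  - by move=> x _; rewrite lee_fin.
split => //; exists u; split => //.
- apply: squeeze => //; first by move=> n; exact: (measurable_ct (mu_ n)).
  by move=> n f; rewrite uHE -!addrA lerDl !addr_ge0 ?sqr_ge0.
- apply: squeeze => //; first by move=> n; exact: (measurable_st (mu_ n)).
  move=> n f; rewrite uHE (addrC ((ct _ _ - _) ^+ 2)) -!addrA lerDl.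
  by rewrite !addr_ge0 ?sqr_ge0.
Qed.

End plane_transforms.

(** * A nonnegative integrable kernel with a tent-shaped transform *)

Section tent_kernel.
Context (R : realType).
Notation mu := (@lebesgue_measure R).
Implicit Types (a x y : R).

Lemma normr_sin_le x : `|sin x| <= `|x|.
Proof.
wlog x0 : x / 0 <= x => [hwlog|].
  have [x0|/ltW x0] := leP 0 x; first exact: hwlog.
  by have := hwlog (- x); rewrite sinN !normrN oppr_ge0; exact.
have [|z _] := @MVT_segment R sin cos 0 x x0 (fun z _ => is_derive_sin z).
  by apply: continuous_subspaceT => z; exact: continuous_sin.
rewrite sin0 !subr0 => ->; rewrite normrM ler_piMl//; exact: cos_max.
Qed.

Lemma one_minus_cos_le x : 1 - cos x <= x ^+ 2.
Proof.
have -> : 1 - cos x = 2 * sin (x / 2) ^+ 2.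
  rewrite [x in cos x](_ : _ = (x / 2) *+ 2); last by rewrite -mulr_natr; field.
  by rewrite cos_mulr2n cos2sin2 mulr2n; ring.
have : `|sin (x / 2)| ^+ 2 <= `|x / 2| ^+ 2.
  by rewrite lerXn2r ?nnegrE//; exact: normr_sin_le.
rewrite !real_normK ?num_real// => H.
have := sqr_ge0 x; nra.
Qed.

Lemma measurable_invr : measurable_fun setT (@GRing.inv R).
Proof.
have m0 : measurable ([set 0] : set (measurableTypeR R)) by exact: measurable_set1.
rewrite -(setUv [set (0 : measurableTypeR R)]).
apply/measurable_funU => //; first exact: measurableC.
split.
  apply: (@eq_measurable_fun _ _ _ _ _ (cst (0 : R))) => // x.
  by rewrite inE/= => ->; rewrite invr0.
apply: open_continuous_measurable_fun.
  by rewrite openC; apply: closed_eq.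
by apply/in_setP => x /= /eqP x0; exact: inv_continuous.
Qed.

(** The Fejer-type kernel; its value at [0] is [0], by the convention [0^-1 = 0]. *)
Definition kern a (x : measurableTypeR R) : R := (1 - cos (2 * pi * a * x)) / x ^+ 2.

Lemma kern_ge0 a x : 0 <= kern a x.
Proof. by rewrite divr_ge0 ?sqr_ge0// subr_ge0 cos_le1. Qed.

Lemma measurable_kern a : measurable_fun setT (kern a).
Proof.
apply: measurable_funM.
  apply: measurable_funB => //; apply: measurableT_comp.
    by apply: continuous_measurable_fun; exact: continuous_cos.
  exact: measurable_funM.
by apply: (measurableT_comp measurable_invr); exact: measurable_funX.
Qed.

Lemma kern_le a x : kern a x <= ((2 * pi * a) ^+ 2 + 2) / (1 + x ^+ 2).
Proof.
rewrite ler_pdivlMr; last by rewrite ltr_pwDl// sqr_ge0.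
rewrite mulrDr mulr1 /kern lerD//.
  have [->|x0] := eqVneq x 0.
    by rewrite expr0n/= invr0 mulr0 sqr_ge0.
  rewrite ler_pdivrMr ?exprn_even_gt0// -exprMn; exact: one_minus_cos_le.
have [->|x0] := eqVneq x 0; first by rewrite expr0n/= mulr0.
rewrite divfK ?sqrf_eq0// lerBlDr -lerBlDl.
by have := cos_max (2 * pi * a * x); rewrite ler_norml => /andP[]; lra.
Qed.

Lemma integrable_oneDsqrV : mu.-integrable setT (fun x => (1 + x ^+ 2)^-1%:E).
Proof.
have p0 x : 0 <= (1 + x ^+ 2)^-1 by rewrite invr_ge0 addr_ge0// sqr_ge0.
apply/integrableP; split.
  apply/measurable_EFinP; apply: (measurableT_comp measurable_invr).
  by apply: measurable_funD => //; exact: measurable_funX.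
under eq_integral do rewrite /= ger0_norm//.
rewrite (@ge0_symfun_integralT R (fun x => (1 + x ^+ 2)^-1)) //; last 2 first.
- exact: (@continuous_oneDsqrV R).
- by move=> x /=; rewrite sqrrN.
rewrite -set_itvcy integral0y_oneDsqr.
by rewrite -EFinM ltry.
Qed.

Lemma integrable_kern a : mu.-integrable setT (EFin \o kern a).
Proof.
apply: (le_integrable measurableT _ _ (integrableZl measurableT
  ((2 * pi * a) ^+ 2 + 2) integrable_oneDsqrV)).
  by apply/measurable_EFinP; exact: measurable_kern.
move=> x _ /=; rewrite lee_fin ger0_norm ?kern_ge0//.
by apply: (le_trans _ (ler_norm _)); exact: kern_le.
Qed.

(** The constant of the tent formula. Only its positivity matters. *)
Definition kern_mass : R := \int[mu]_x kern 1 x.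

Lemma kern_mass_gt0 : 0 < kern_mass.
Proof.
(* The cosine is nonpositive on the middle half of its period. *)
have h : (0 : R) < 4^-1 by rewrite invr_gt0.
have lb x : 4^-1 <= x <= 3 / 4 -> 1 <= kern 1 x.
  move=> /andP[x1 x2]; have x0 : 0 < x by exact: lt_le_trans x1.
  have c0 : cos (2 * pi * 1 * x) <= 0.
    rewrite -[X in cos X](subrK pi) cosDpi oppr_le0 cos_ge0_pihalf//.
    have := pi_gt0 R => p0; apply/andP; split; nra.
  rewrite /kern ler_pdivlMr ?exprn_gt0// mul1r.
  apply: (@le_trans _ _ 1); last by rewrite lerBrDr gerDl.
  by rewrite exprn_ile1 ?(ltW x0)// (le_trans x2)// ler_pdivrMr// mul1r ler_nat.
pose D := `[4^-1 : R, 3 / 4]%classic.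
have mD : measurable D by exact: measurable_itv.
have leD x : \1_D x <= kern 1 x.
  rewrite indicE; have [/set_mem/=|] := boolP (x \in D); last by rewrite kern_ge0.
  by rewrite /D/= in_itv/=; exact: lb.
apply: (@lt_le_trans _ _ (\int[mu]_x (\1_D x))).
  rewrite /Rintegral integral_indic// setIT.
  rewrite [X in fine X](lebesgue_measure_itv `[4^-1, 3 / 4]%R)/= lte_fin.
  by rewrite ifT; [rewrite /= ; lra|lra].
apply: le_Rintegral => //; last exact: integrable_kern.
apply: (le_integrable measurableT _ _ (integrable_kern 1)).
  exact/measurable_EFinP.
by move=> x _ /=; rewrite lee_fin !ger0_norm ?kern_ge0//.
Qed.

(** By the change of variables [x |-> a x]. *)
Lemma Rintegral_kern a : \int[mu]_x kern a x = kern_mass * `|a|.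
Proof.
wlog a0 : a / 0 <= a => [hwlog|].
  have [a0|/ltW a0] := leP 0 a; first exact: hwlog.
  rewrite -normrN -hwlog ?oppr_ge0//; apply: eq_Rintegral => x _.
  by rewrite /kern mulrN mulNr cosN.
move: a0; rewrite le_eqVlt => /predU1P[<-|a0].
  rewrite normr0 mulr0 (_ : kern 0 = cst 0) ?Rintegral_cst ?mul0r//.
  by apply/funext => x; rewrite /kern mulr0 mul0r cos0 subrr mul0r.
rewrite gtr0_norm// /kern_mass /Rintegral.
have kE x : kern a x = a ^+ 2 * kern 1 (a * x + 0).
  rewrite /kern (_ : 2 * pi * 1 * (a * x + 0) = 2 * pi * a * x); last ring.
  rewrite addr0 exprMn; have [->|x0] := eqVneq x 0.
    by rewrite expr0n/= !(mulr0, invr0).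
  by field; rewrite x0 gt_eqF.
under eq_integral do rewrite kE EFinM.
have [_ mA HA] := @lebesgue_affine R a 0 a0.
rewrite ge0_integralZl//; last 3 first.
- exact/measurable_EFinP/(measurableT_comp (measurable_kern 1)).
- by move=> x _; rewrite lee_fin kern_ge0.
- by rewrite lee_fin sqr_ge0.
rewrite (HA (fun x => (kern 1 x)%:E)); last 2 first.
- by apply/measurable_EFinP; exact: measurable_kern.
- by move=> x; rewrite lee_fin kern_ge0.
rewrite muleA -EFinM fineM//; last exact: integrable_fin_num (integrable_kern 1).
rewrite /= [RHS]mulrC; congr (_ * _); by field; rewrite gt_eqF.
Qed.

(** The tent of half-width [a], written as a second difference of the absolute value;
    see [tentE] for the closed form. *)
Definition tent a y : R := `|y + a| / 2 + `|y - a| / 2 - `|y|.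

Lemma integrable_kern_mul a (k : measurableTypeR R -> R) : measurable_fun setT k ->
  (forall x, `|k x| <= 1) -> mu.-integrable setT (EFin \o (fun x => k x * kern a x)).
Proof. by move=> mk k1; exact: (integrable_bounded_mul mk k1 (integrable_kern a)). Qed.

Lemma measurable_cosM y :
  measurable_fun setT (fun x : measurableTypeR R => cos (2 * pi * y * x)).
Proof.
apply: measurableT_comp; last exact: measurable_funM.
by apply: continuous_measurable_fun; exact: continuous_cos.
Qed.

Lemma measurable_sinM y :
  measurable_fun setT (fun x : measurableTypeR R => sin (2 * pi * y * x)).
Proof.
apply: measurableT_comp; last exact: measurable_funM.
by apply: continuous_measurable_fun; exact: continuous_sin.
Qed.

(** The product [cos (2 pi y x) * kern a x] is a second difference of
    [y |-> kern y x], and [\int kern y] is proportional to [|y|]. *)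
Lemma Rintegral_cos_kern a y :
  \int[mu]_x (cos (2 * pi * y * x) * kern a x) = kern_mass * tent a y.
Proof.
transitivity (\int[mu]_x ((2^-1 * kern (y + a) x + 2^-1 * kern (y - a) x) - kern y x)).
  apply: eq_Rintegral => x _; rewrite /kern.
  rewrite [2 * pi * (y + a) * x](_ : _ = 2 * pi * y * x + 2 * pi * a * x); last ring.
  rewrite [2 * pi * (y - a) * x](_ : _ = 2 * pi * y * x - 2 * pi * a * x); last ring.
  rewrite cosD cosB; have [->|x0] := eqVneq x 0.
    by rewrite expr0n/= !(mulr0, invr0, subrr, addr0).
  by field.
have I b c : mu.-integrable setT (EFin \o (fun x => c * kern b x)).
  exact: (integrableZl measurableT c (integrable_kern b)).
rewrite RintegralB//; last 2 first.
- by apply: (integrableD measurableT (I _ _) (I _ _)).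
- exact: integrable_kern.
rewrite RintegralD// !RintegralZl// ?Rintegral_kern; try exact: integrable_kern.
by rewrite /tent; ring.
Qed.

Lemma Rintegral_sin_kern a y : \int[mu]_x (sin (2 * pi * y * x) * kern a x) = 0.
Proof.
set I := Rintegral _ _ _.
suff : I = - I by lra.
have IE := @scales_integral _ _ _ mu _
  (fun x : measurableTypeR R => (sin (2 * pi * y * x) * kern a x)%:E)
  (lebesgue_reflection R).
rewrite {1}/I /Rintegral -IE; last first.
  apply/measurable_EFinP; apply: measurable_funM; first exact: measurable_sinM.
  exact: measurable_kern.
rewrite -/(Rintegral mu setT (fun x => sin (2 * pi * y * - x) * kern a (- x))).
rewrite -[RHS]mulN1r -RintegralZl//; last first.
  by apply: integrable_kern_mul => [|x]; [exact: measurable_sinM|exact: sin_max].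
apply: eq_Rintegral => x _.
by rewrite mulrN sinN /kern mulrN cosN sqrrN; ring.
Qed.

End tent_kernel.

Section plane_kernel.
Context (R : realType).
Notation mu := (@lebesgue_measure R).
Notation leb := (leb2 R).
Notation L := (measurableTypeR R).
Notation R2 := (measurableTypeR R * measurableTypeR R)%type.
Implicit Types (f g : L -> R) (a b : R) (x y : R2).

Lemma integrable_tensor f g :
  mu.-integrable setT (EFin \o f) -> mu.-integrable setT (EFin \o g) ->
  leb.-integrable setT (EFin \o (fun x => f x.1 * g x.2)).
Proof.
move=> If ig.
have mf : measurable_fun setT f by apply/measurable_EFinP; exact: measurable_int If.
have mg : measurable_fun setT g by apply/measurable_EFinP; exact: measurable_int ig.
have mfg : measurable_fun setT (EFin \o (fun x : R2 => f x.1 * g x.2)).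
  by apply/measurable_EFinP; apply: measurable_funM; apply: measurableT_comp.
apply/(@integrable12ltyP _ _ _ _ _ mu mu) => //.
rewrite [ltLHS](_ : _ = \int[mu]_x (`|f x|%:E * \int[mu]_y `|g y|%:E))%E; last first.
  apply: eq_integral => x _; rewrite -ge0_integralZl//; last first.
    by apply/measurable_EFinP; exact: measurableT_comp.
  by apply: eq_integral => y _; rewrite /= normrM EFinM.
have fg : (\int[mu]_y `|g y|%:E)%E \is a fin_num.
  by rewrite ge0_fin_numE; [case/integrableP : ig|exact: integral_ge0].
rewrite -(fineK fg) ge0_integralZr//; last 2 first.
- by apply/measurable_EFinP; exact: measurableT_comp.
- by rewrite lee_fin fine_ge0//; exact: integral_ge0.
rewrite lte_mul_pinfty// ?ltry//; first exact: integral_ge0.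
by rewrite ge0_fin_numE; [case/integrableP : If|exact: integral_ge0].
Qed.

Lemma Rintegral_tensor f g :
  mu.-integrable setT (EFin \o f) -> mu.-integrable setT (EFin \o g) ->
  \int[leb]_x (f x.1 * g x.2) = \int[mu]_x f x * \int[mu]_x g x.
Proof.
move=> If ig; have ifg := integrable_tensor If ig.
rewrite /Rintegral -[X in fine X = _](@integral12_prod_meas1 _ _ _ _ _ mu mu _ ifg) /fubini_F.
rewrite [X in fine X](_ : _ = \int[mu]_x ((f x)%:E * \int[mu]_y (g y)%:E))%E; last first.
  by apply: eq_integral => x _; rewrite -integralZl.
have fg := integrable_fin_num measurableT ig.
rewrite -(fineK fg) integralZr// fineM//; exact: integrable_fin_num.
Qed.

Lemma sqint_bounded (C : R) (h : R2 -> R) : leb.-integrable setT (EFin \o h) ->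
  (forall x, `|h x| <= C) -> sqint leb h.
Proof.
move=> ih hC.
have mh : measurable_fun setT h by apply/measurable_EFinP; exact: measurable_int ih.
apply/sqintP; split => //.
apply: (le_integrable measurableT _ _ (integrableZl measurableT C ih)).
  by apply/measurable_EFinP; exact: measurable_funX.
move=> x _ /=; rewrite lee_fin normrX expr2 normrM.
by rewrite ler_wpM2r// (le_trans (hC x))// ler_norm.
Qed.

(** The tensor products of the kernels in each variable, and of the tents. *)
Definition kern2 a b x : R := kern a x.1 * kern b x.2.

Lemma integrable_kern2 a b : leb.-integrable setT (EFin \o kern2 a b).
Proof. exact: (integrable_tensor (integrable_kern a) (integrable_kern b)). Qed.

Lemma kern_bounded a (x : L) : `|kern a x| <= (2 * pi * a) ^+ 2 + 2.
Proof.
rewrite ger0_norm ?kern_ge0//; apply: (le_trans (kern_le a x)).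
have x2 : 0 < 1 + x ^+ 2 by rewrite ltr_pwDl// sqr_ge0.
rewrite ler_pdivrMr// ler_peMr ?addr_ge0 ?sqr_ge0//.
by rewrite lerDl sqr_ge0.
Qed.

Lemma sqint_kern2 a b : sqint leb (kern2 a b).
Proof.
apply: (sqint_bounded (C := ((2 * pi * a) ^+ 2 + 2) * ((2 * pi * b) ^+ 2 + 2))).
  exact: integrable_kern2.
by move=> x; rewrite normrM ler_pM// kern_bounded.
Qed.

Definition tent2 a b y : R := tent a y.1 * tent b y.2.

Lemma phaseE y x : phase y x = 2 * pi * y.1 * x.1 + 2 * pi * y.2 * x.2.
Proof. by rewrite /phase /dot2; ring. Qed.

Lemma integrable_cosk a (y : L) :
  mu.-integrable setT (EFin \o (fun x : L => cos (2 * pi * y * x) * kern a x)).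
Proof.
by apply: integrable_kern_mul => [|x]; [exact: measurable_cosM|exact: cos_max].
Qed.

Lemma integrable_sink a (y : L) :
  mu.-integrable setT (EFin \o (fun x : L => sin (2 * pi * y * x) * kern a x)).
Proof.
by apply: integrable_kern_mul => [|x]; [exact: measurable_sinM|exact: sin_max].
Qed.

Lemma ct_kern2 a b y : ct (kern2 a b) y = kern_mass R ^+ 2 * tent2 a b y.
Proof.
rewrite /ct.
transitivity (\int[leb]_x
  ((cos (2 * pi * y.1 * x.1) * kern a x.1) * (cos (2 * pi * y.2 * x.2) * kern b x.2) -
   (sin (2 * pi * y.1 * x.1) * kern a x.1) * (sin (2 * pi * y.2 * x.2) * kern b x.2))).
  by apply: eq_Rintegral => x _; rewrite phaseE cosD /kern2; ring.
have i1 := integrable_cosk a y.1; have i2 := integrable_cosk b y.2.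
have i3 := integrable_sink a y.1; have i4 := integrable_sink b y.2.
rewrite RintegralB//; last 2 first.
- exact: (integrable_tensor i1 i2).
- exact: (integrable_tensor i3 i4).
rewrite (Rintegral_tensor i1 i2) (Rintegral_tensor i3 i4).
by rewrite !Rintegral_cos_kern !Rintegral_sin_kern /tent2; ring.
Qed.

Lemma st_kern2 a b y : st (kern2 a b) y = 0.
Proof.
rewrite /st.
transitivity (\int[leb]_x
  ((sin (2 * pi * y.1 * x.1) * kern a x.1) * (cos (2 * pi * y.2 * x.2) * kern b x.2) +
   (cos (2 * pi * y.1 * x.1) * kern a x.1) * (sin (2 * pi * y.2 * x.2) * kern b x.2))).
  by apply: eq_Rintegral => x _; rewrite phaseE sinD /kern2; ring.
have i1 := integrable_cosk a y.1; have i2 := integrable_cosk b y.2.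
have i3 := integrable_sink a y.1; have i4 := integrable_sink b y.2.
rewrite RintegralD//; last 2 first.
- exact: (integrable_tensor i3 i2).
- exact: (integrable_tensor i1 i4).
rewrite (Rintegral_tensor i3 i2) (Rintegral_tensor i1 i4).
by rewrite !Rintegral_cos_kern !Rintegral_sin_kern; ring.
Qed.

(** The modulations of the kernel by cosine and sine waves. *)
Definition cosk a b y x : R := cos (phase y x) * kern2 a b x.
Definition sink a b y x : R := sin (phase y x) * kern2 a b x.

(** Translation by [p], and the opposite of a vector. *)
Definition shift (p x : R2) : R2 := (x.1 + p.1, x.2 + p.2).

Definition opp2 (p : R2) : R2 := (- p.1, - p.2).

Lemma phaseD y p x : phase (shift p y) x = phase y x + phase p x.
Proof. by rewrite !phaseE /=; ring. Qed.

Lemma phaseN p x : phase (opp2 p) x = - phase p x.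
Proof. by rewrite !phaseE /=; ring. Qed.

Lemma integrable_cosk2 a b y : leb.-integrable setT (EFin \o cosk a b y).
Proof. by apply: integrable_cos_phase; exact: integrable_kern2. Qed.

Lemma integrable_sink2 a b y : leb.-integrable setT (EFin \o sink a b y).
Proof. by apply: integrable_sin_phase; exact: integrable_kern2. Qed.

Lemma sqint_cosk a b y : sqint leb (cosk a b y).
Proof.
apply: (sqint_le (C := 1)) (sqint_kern2 a b) _ => [|x].
  by apply/measurable_EFinP; exact: measurable_int (integrable_cosk2 a b y).
by rewrite mul1r normrM ler_piMl// cos_max.
Qed.

Lemma sqint_sink a b y : sqint leb (sink a b y).
Proof.
apply: (sqint_le (C := 1)) (sqint_kern2 a b) _ => [|x].
  by apply/measurable_EFinP; exact: measurable_int (integrable_sink2 a b y).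
by rewrite mul1r normrM ler_piMl// sin_max.
Qed.

(** The transforms of modulated kernels are combinations of translated tents, by the
    product-to-sum formulas. *)
Lemma ct_cosk a b p y : ct (cosk a b p) y =
  kern_mass R ^+ 2 *
  (2^-1 * tent2 a b (shift (opp2 p) y) + 2^-1 * tent2 a b (shift p y)).
Proof.
transitivity (2^-1 * ct (kern2 a b) (shift (opp2 p) y) +
  2^-1 * ct (kern2 a b) (shift p y)).
  have I q := integrable_cos_phase q (integrable_kern2 a b).
  have IZ q : leb.-integrable setT
      (EFin \o (fun x => 2^-1 * (cos (phase q x) * kern2 a b x))).
    exact: (integrableZl measurableT 2^-1 (I q)).
  rewrite -!RintegralZl//.
  rewrite -RintegralD//.
  apply: eq_Rintegral => x _; rewrite !phaseD phaseN /cosk !cosD cosN sinN; by field.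
by rewrite !ct_kern2; ring.
Qed.

Lemma st_sink a b p y : st (sink a b p) y =
  kern_mass R ^+ 2 *
  (2^-1 * tent2 a b (shift (opp2 p) y) - 2^-1 * tent2 a b (shift p y)).
Proof.
transitivity (2^-1 * ct (kern2 a b) (shift (opp2 p) y) -
  2^-1 * ct (kern2 a b) (shift p y)).
  have I q := integrable_cos_phase q (integrable_kern2 a b).
  have IZ q : leb.-integrable setT
      (EFin \o (fun x => 2^-1 * (cos (phase q x) * kern2 a b x))).
    exact: (integrableZl measurableT 2^-1 (I q)).
  rewrite -!RintegralZl//.
  rewrite -RintegralB//.
  apply: eq_Rintegral => x _; rewrite !phaseD phaseN /sink !cosD cosN sinN; by field.
by rewrite !ct_kern2; ring.
Qed.

Lemma st_cosk a b p y : st (cosk a b p) y = 0.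
Proof.
transitivity (2^-1 * st (kern2 a b) (shift (opp2 p) y) +
  2^-1 * st (kern2 a b) (shift p y)).
  have I q := integrable_sin_phase q (integrable_kern2 a b).
  have IZ q : leb.-integrable setT
      (EFin \o (fun x => 2^-1 * (sin (phase q x) * kern2 a b x))).
    exact: (integrableZl measurableT 2^-1 (I q)).
  rewrite -!RintegralZl//.
  rewrite -RintegralD//.
  apply: eq_Rintegral => x _; rewrite !phaseD phaseN /cosk !sinD cosN sinN; by field.
by rewrite !st_kern2; ring.
Qed.

Lemma ct_sink a b p y : ct (sink a b p) y = 0.
Proof.
transitivity (2^-1 * st (kern2 a b) (shift p y) -
  2^-1 * st (kern2 a b) (shift (opp2 p) y)).
  have I q := integrable_sin_phase q (integrable_kern2 a b).
  have IZ q : leb.-integrable setT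
      (EFin \o (fun x => 2^-1 * (sin (phase q x) * kern2 a b x))).
    exact: (integrableZl measurableT 2^-1 (I q)).
  rewrite -!RintegralZl//.
  rewrite -RintegralB//.
  apply: eq_Rintegral => x _; rewrite !phaseD phaseN /sink !sinD cosN sinN; by field.
by rewrite !st_kern2; ring.
Qed.

End plane_kernel.

(** * Duality with tents *)

Section tents.
Context (R : realType).
Notation mu := (@lebesgue_measure R).
Notation leb := (leb2 R).
Notation L := (measurableTypeR R).
Notation R2 := (measurableTypeR R * measurableTypeR R)%type.
Implicit Types (a b : R) (p q : R2).

Lemma tentE a (y : R) : 0 <= a -> tent a y = Num.max (a - `|y|) 0.
Proof.
move=> a0; rewrite /tent; have [l|l] := leP (a - `|y|) 0;
  case: (ger0P (y + a)) => ?; case: (ger0P (y - a)) => ?;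
  move: l; case: (ger0P y) => ? ?; lra.
Qed.

Lemma measurable_tent a : measurable_fun setT (fun y : L => tent a y).
Proof.
apply: measurable_funB; last exact: normr_measurable.
apply: measurable_funD; apply: measurable_funM => //; apply: measurableT_comp => //.
  exact: measurable_funD.
exact: measurable_funB.
Qed.

Lemma tent_ge0 a y : 0 <= a -> 0 <= tent a y.
Proof. by move=> a0; rewrite tentE// le_max lexx orbT. Qed.

Lemma tent_le a y : 0 <= a -> tent a y <= a.
Proof. by move=> a0; rewrite tentE// ge_max a0 andbT gerBl. Qed.

Lemma integrable_tent a : 0 <= a ->
  mu.-integrable setT (EFin \o (fun y : L => tent a y)).
Proof.
move=> a0.
apply: (le_integrable measurableT _ _ (integrableZl measurableT
  (a * (1 + a ^+ 2)) (integrable_oneDsqrV R))).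
  by apply/measurable_EFinP; exact: measurable_tent.
move=> y _ /=; rewrite lee_fin ger0_norm ?tent_ge0//.
apply: (le_trans _ (ler_norm _)); rewrite ler_pdivlMr; last first.
  by rewrite ltr_pwDl// sqr_ge0.
have [ya|ya] := leP `|y| a; last first.
  rewrite tentE// (elimT max_idPr) ?mul0r; last by rewrite subr_le0 ltW.
  by rewrite mulr_ge0// addr_ge0// sqr_ge0.
apply: ler_pM; rewrite ?tent_ge0 ?tent_le ?addr_ge0 ?sqr_ge0//.
rewrite lerD2l -(real_normK (num_real y)); exact: lerXn2r.
Qed.

Lemma scales_shift p : scales leb 1 (shift p).
Proof.
have := leb2_affine p (@ltr01 R); rewrite invr1 mulr1; apply: eq_scales => x.
by rewrite !mul1r.
Qed.

Lemma integrable_tent2 a b : 0 <= a -> 0 <= b ->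
  leb.-integrable setT (EFin \o tent2 a b).
Proof.
by move=> a0 b0; exact: (integrable_tensor (integrable_tent a0) (integrable_tent b0)).
Qed.

Lemma sqint_tent2 a b p : 0 <= a -> 0 <= b ->
  sqint leb (fun y => tent2 a b (shift p y)).
Proof.
move=> a0 b0; apply: (scales_sqint (scales_shift p)).
apply: (sqint_bounded (C := a * b)); first exact: integrable_tent2.
move=> y; rewrite ger0_norm; last by rewrite mulr_ge0// tent_ge0.
by rewrite ler_pM ?tent_ge0 ?tent_le.
Qed.

(** The duality of the cosine and sine transforms passes to the limit in L^2. *)
Lemma L2ft_duality h A B v : L2ft h A B ->
  leb.-integrable setT (EFin \o v) -> sqint leb v ->
  sqint leb (ct v) -> sqint leb (st v) ->
  \int[leb]_x (A x * v x) = \int[leb]_x (h x * ct v x) /\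
  \int[leb]_x (B x * v x) = \int[leb]_x (h x * st v x).
Proof.
move=> [sh sA sB [u [su uh uA uB]]] iv sv sc ss.
have mu_ n : measurable_fun setT (u n) by case: (su n) => _ [].
have mc n : measurable_fun setT (ct (u n)) by exact: (measurable_ct (mu_ n)).
have ms n : measurable_fun setT (st (u n)) by exact: (measurable_st (mu_ n)).
split.
- have H1 := l2cvg_weak mc sA sv uA.
  have := l2cvg_weak mu_ sh sc uh.
  under eq_fun do rewrite -ct_duality ?(su _).1//.
  by move/cvg_lim => <-//; apply/esym/cvg_lim.
- have H1 := l2cvg_weak ms sB sv uB.
  have := l2cvg_weak mu_ sh ss uh.
  under eq_fun do rewrite -st_duality ?(su _).1//.
  by move/cvg_lim => <-//; apply/esym/cvg_lim.
Qed.

Lemma sqint_ct_cosk a b p : 0 <= a -> 0 <= b -> sqint leb (ct (cosk a b p)).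
Proof.
move=> a0 b0; rewrite (_ : ct _ = fun y =>
    kern_mass R ^+ 2 * 2^-1 * tent2 a b (shift (opp2 p) y) +
    kern_mass R ^+ 2 * 2^-1 * tent2 a b (shift p y)).
  by apply: sqint_comb; exact: sqint_tent2.
by apply/funext => y; rewrite ct_cosk; ring.
Qed.

Lemma sqint_st_sink a b p : 0 <= a -> 0 <= b -> sqint leb (st (sink a b p)).
Proof.
move=> a0 b0; rewrite (_ : st _ = fun y =>
    kern_mass R ^+ 2 * 2^-1 * tent2 a b (shift (opp2 p) y) +
    - (kern_mass R ^+ 2 * 2^-1) * tent2 a b (shift p y)).
  by apply: sqint_comb; exact: sqint_tent2.
by apply/funext => y; rewrite st_sink; ring.
Qed.

Lemma sqint_0 : sqint leb (fun=> 0).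
Proof.
split => //; under eq_integral do rewrite expr0n/=.
by rewrite integral0.
Qed.

Lemma sqint_st_cosk a b p : sqint leb (st (cosk a b p)).
Proof.
rewrite (_ : st _ = fun=> 0); first exact: sqint_0.
by apply/funext => y; rewrite st_cosk.
Qed.

Lemma sqint_ct_sink a b p : sqint leb (ct (sink a b p)).
Proof.
rewrite (_ : ct _ = fun=> 0); first exact: sqint_0.
by apply/funext => y; rewrite ct_sink.
Qed.

Lemma Rintegral0 (k : R2 -> R) : (forall x, k x = 0) -> \int[leb]_x k x = 0.
Proof.
by move=> k0; under eq_Rintegral do rewrite k0; rewrite Rintegral_cst// mul0r.
Qed.

(** A function whose Fourier transform vanishes is orthogonal to all the tents. *)
Lemma L2ft0_tent_orthogonal h a b p : 0 <= a -> 0 <= b -> L2ft h (fun=> 0) (fun=> 0) ->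
  \int[leb]_y (h y * tent2 a b (shift (opp2 p) y)) = 0.
Proof.
move=> a0 b0 h0; have [sh _ _ _] := h0.
have [+ _] := L2ft_duality h0 (integrable_cosk2 a b p) (sqint_cosk a b p)
  (sqint_ct_cosk p a0 b0) (sqint_st_cosk a b p).
have [_ +] := L2ft_duality h0 (integrable_sink2 a b p) (sqint_sink a b p)
  (sqint_ct_sink a b p) (sqint_st_sink p a0 b0).
move=> Es Ec.
have Hs : \int[leb]_y (h y * st (sink a b p) y) = 0.
  by rewrite -Es; apply: Rintegral0 => x; rewrite mul0r.
have Hc : \int[leb]_y (h y * ct (cosk a b p) y) = 0.
  by rewrite -Ec; apply: Rintegral0 => x; rewrite mul0r.
(* The sum of the two transforms is a single translated tent. *)
have : \int[leb]_y (h y * ct (cosk a b p) y) +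
    \int[leb]_y (h y * st (sink a b p) y) = 0.
  by rewrite Hs Hc addr0.
rewrite -RintegralD//; last 2 first.
- exact: (sqint_mul sh (sqint_ct_cosk p a0 b0)).
- exact: (sqint_mul sh (sqint_st_sink p a0 b0)).
under eq_Rintegral => x _.
  rewrite (_ : _ + _ = kern_mass R ^+ 2 * (h x * tent2 a b (shift (opp2 p) x))); last first.
    by rewrite ct_cosk st_sink; field.
  over.
rewrite RintegralZl//; last exact: (sqint_mul sh (sqint_tent2 (opp2 p) a0 b0)).
move/eqP; rewrite mulf_eq0 expf_eq0/= gt_eqF ?kern_mass_gt0//=.
by move/eqP.
Qed.

End tents.

(** * From tents to rectangles *)

Section rectangles.
Context (R : realType).
Notation mu := (@lebesgue_measure R).
Notation leb := (leb2 R).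
Notation L := (measurableTypeR R).
Notation R2 := (measurableTypeR R * measurableTypeR R)%type.
Implicit Types (a b : R) (p q : R2).

(** The half-width [a] diminished by [1 / (n + 1)], and kept nonnegative. *)
Definition inner (n : nat) a : R := Num.max (a - n.+1%:R^-1) 0.

(** A trapezoid, as a rescaled difference of two tents; it converges pointwise to the
    indicator of the open interval of half-width [a] (see [trap_near]). *)
Definition trap (n : nat) a (t : R) : R := n.+1%:R * (tent a t - tent (inner n a) t).

Lemma inner_ge0 n a : 0 <= inner n a.
Proof. by rewrite le_max lexx orbT. Qed.

Lemma trap_near a t : 0 < a ->
  \forall n \near \oo, trap n a t = (`|t| < a)%R%:R.
Proof.
move=> a0; have [ta|ta] := ltP `|t| a; last first.
  apply: nearW => n; rewrite /trap (tentE _ (ltW a0)) (tentE _ (inner_ge0 _ _)).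
  have i : inner n a <= a by rewrite ge_max (ltW a0) andbT gerBl invr_ge0.
  rewrite !(elimT max_idPr) ?subrr ?mulr0// subr_le0//.
  exact: le_trans ta.
have at0 : 0 < a - `|t| by rewrite subr_gt0.
have := near_infty_natSinv_lt (PosNum at0).
apply: filterS => n Hn.
have n0 : (n.+1%:R : R) != 0 by rewrite pnatr_eq0.
move: n0; rewrite /trap /inner -[X in X * _]invrK -invr_eq0.
have {Hn} : n.+1%:R^-1 < a - `|t| := Hn.
move: (n.+1%:R^-1 : R) => r rt r0.
have t0 := normr_ge0 t.
have i0 : 0 <= a - r by lra.
rewrite (elimT max_idPl)// (tentE _ (ltW a0)) (tentE _ i0).
rewrite (elimT max_idPl); last lra.
rewrite (elimT max_idPl); last lra.
by transitivity (1 : R); first by field.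
Qed.

(** A bound that does not depend on [n], for dominated convergence. *)
Lemma trap_bound n a t : 0 < a -> 0 <= trap n a t <= a^-1 * tent (2 * a) t.
Proof.
move=> a0; have n0 : (0 : R) < n.+1%:R by [].
have n1 : (0 : R) < n.+1%:R^-1 by rewrite invr_gt0.
have nn : n.+1%:R * n.+1%:R^-1 = 1 :> R by rewrite divff// gt_eqF.
have ia : inner n a <= a by rewrite ge_max (ltW a0) andbT gerBl invr_ge0.
have ai : a - n.+1%:R^-1 <= inner n a by rewrite le_max lexx.
have i0 := inner_ge0 n a.
have a20 : 0 <= 2 * a by rewrite mulr_ge0// ltW.
rewrite /trap (tentE _ (ltW a0)) (tentE _ i0) (tentE _ a20).
move: (inner n a) (n.+1%:R^-1 : R) (n.+1%:R : R) n0 n1 nn ia ai i0.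
move=> i r N N0 r0 Nr ia ai i0; have t0 := normr_ge0 t.
have [ta|ta] := leP `|t| a; last first.
  rewrite (elimT (@max_idPr _ _ (a - _) _)); last lra.
  rewrite (elimT (@max_idPr _ _ (i - _) _)); last lra.
  by rewrite subrr mulr0 lexx/= mulr_ge0 ?invr_ge0 ?(ltW a0)// le_max lexx orbT.
rewrite (elimT (@max_idPl _ _ (a - _) _)); last lra.
rewrite (elimT (@max_idPl _ _ (2 * a - _) _)); last lra.
have m0 : 0 <= Num.max (i - `|t|) 0 by rewrite le_max lexx orbT.
have m1 : i - `|t| <= Num.max (i - `|t|) 0 by rewrite le_max lexx.
have m2 : Num.max (i - `|t|) 0 <= a - `|t| by rewrite ge_max; apply/andP; split; lra.
apply/andP; split; first by rewrite mulr_ge0 ?subr_ge0// ltW.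
apply: (@le_trans _ _ 1); last by rewrite ler_pdivlMl//; lra.
by rewrite -[leRHS]Nr ler_pM2l//; lra.
Qed.

Lemma shift_measurable p : measurable_fun setT (shift p).
Proof. by case: (scales_shift p). Qed.

Lemma measurable_trap n a : measurable_fun setT (fun t : L => trap n a t).
Proof.
by apply: measurable_funM => //; apply: measurable_funB; exact: measurable_tent.
Qed.

(** Orthogonality to all the translated tents. *)
Definition tent_orthogonal (h : R2 -> R) : Prop := forall a b p, 0 <= a -> 0 <= b ->
  \int[leb]_y (h y * tent2 a b (shift p y)) = 0.

Lemma trap_orthogonal h a b p n : sqint leb h -> tent_orthogonal h ->
  0 < a -> 0 < b ->
  (\int[leb]_y (h y * (trap n a (shift p y).1 * trap n b (shift p y).2))%:E = 0)%E.
Proof.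
move=> sh h0 a0 b0; pose N : R := n.+1%:R.
have I c d : 0 <= c -> 0 <= d ->
    leb.-integrable setT (EFin \o (fun y => h y * tent2 c d (shift p y))).
  by move=> c0 d0; exact: (sqint_mul sh (sqint_tent2 p c0 d0)).
have E c d (c0 : 0 <= c) (d0 : 0 <= d) :
    (\int[leb]_y (h y * tent2 c d (shift p y))%:E = 0)%E.
  by rewrite -EFin_Rintegral ?h0//; exact: I.
have ia := inner_ge0 n a; have ib := inner_ge0 n b.
have a0' := ltW a0; have b0' := ltW b0.
transitivity (\int[leb]_y ((N * N)%:E * (((h y * tent2 a b (shift p y))%:E -
    (h y * tent2 a (inner n b) (shift p y))%:E) -
    ((h y * tent2 (inner n a) b (shift p y))%:E -
     (h y * tent2 (inner n a) (inner n b) (shift p y))%:E))))%E.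
  apply: eq_integral => y _; rewrite -!EFinB -EFinM; congr EFin.
  by rewrite /trap /tent2 -/N; ring.
have I1 := integrableB measurableT (I _ _ a0' b0') (I _ _ a0' ib).
have I2 := integrableB measurableT (I _ _ ia b0') (I _ _ ia ib).
rewrite integralZl//; last by apply: (integrableB measurableT I1 I2).
rewrite integralB//; try exact: I.
rewrite integralB//; try exact: I.
rewrite integralB//; try exact: I.
by rewrite !E// !sube0 mule0.
Qed.

(** By dominated convergence, from trapezoids to indicators of rectangles. *)
Lemma window_orthogonal h a b p : sqint leb h -> tent_orthogonal h ->
  0 < a -> 0 < b ->
  (\int[leb]_y (h y *
    ((`|(shift p y).1| < a)%R%:R * (`|(shift p y).2| < b)%R%:R))%:E = 0)%E.
Proof.
move=> sh h0 a0 b0.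
have mh : measurable_fun setT h by case: sh.
have a20 : 0 <= 2 * a by rewrite mulr_ge0// ltW.
have b20 : 0 <= 2 * b by rewrite mulr_ge0// ltW.
pose f_ n (y : R2) := (h y * (trap n a (shift p y).1 * trap n b (shift p y).2))%:E.
pose f (y : R2) :=
  (h y * ((`|(shift p y).1| < a)%R%:R * (`|(shift p y).2| < b)%R%:R))%:E.
pose g (y : R2) := (`|(a^-1 * b^-1) * (h y * tent2 (2 * a) (2 * b) (shift p y))|)%:E.
have ms := shift_measurable p.
have mf_ n : measurable_fun setT (f_ n).
  apply/measurable_EFinP; apply: measurable_funM => //; apply: measurable_funM.
    by apply: (measurableT_comp (measurable_trap n a)); exact: measurableT_comp ms.
  by apply: (measurableT_comp (measurable_trap n b)); exact: measurableT_comp ms.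
have f_f y : f_ ^~ y @ \oo --> f y.
  apply: cvg_near_cst.
  apply: filterS2 (trap_near (shift p y).1 a0) (trap_near (shift p y).2 b0) => n.
  by rewrite /f_ /f => -> ->.
have mf : measurable_fun setT f.
  by apply: (emeasurable_fun_cvg f_) => // y _; exact: f_f.
have ig : leb.-integrable setT g.
  apply: (@integrable_norm _ _ _ leb setT
    (fun y => (a^-1 * b^-1) * (h y * tent2 (2 * a) (2 * b) (shift p y)))).
  exact: (integrableZl measurableT (a^-1 * b^-1)
    (sqint_mul sh (sqint_tent2 p a20 b20))).
have f_g n y : (`|f_ n y| <= g y)%E.
  rewrite /f_ /g lee_fin [X in _ <= `|X|]mulrCA normrM [leRHS]normrM ler_wpM2l//.
  have /andP[l1 l2] := trap_bound n (shift p y).1 a0.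
  have /andP[l3 l4] := trap_bound n (shift p y).2 b0.
  rewrite normrM (ger0_norm l1) (ger0_norm l3).
  apply: (le_trans (ler_pM l1 l3 l2 l4)); apply: (le_trans _ (ler_norm _)).
  by rewrite /tent2 mulrACA.
have [_ _] := dominated_convergence measurableT mf_ mf (aeW _ (fun y _ => f_f y)) ig
  (aeW _ (fun y n _ => f_g n y)).
under eq_fun do rewrite trap_orthogonal//.
by move/cvg_lim => <-//; rewrite lim_cst.
Qed.

Lemma itv_window (x y t : R) : x < y ->
  (t \in `]x, y[) = (`|t + - ((x + y) / 2)| < (y - x) / 2).
Proof.
move=> xy; rewrite in_itv/= ltr_norml; apply/idP/idP => /andP[? ?]; apply/andP; split; lra.
Qed.

Lemma rectangle_orthogonal h (x y x' y' : R) : sqint leb h -> tent_orthogonal h ->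
  (\int[leb]_(z in `]x, y[%classic `*` `]x', y'[%classic) (h z)%:E = 0)%E.
Proof.
move=> sh h0.
have e0 (u v : R) : v <= u -> `]u, v[%classic = set0 :> set L.
  by move=> vu; rewrite set_itv_ge// bnd_simp -leNgt.
have [xy|yx] := ltP x y; last by rewrite e0// set0X integral_set0.
have [xy'|yx'] := ltP x' y'; last by rewrite (e0 x')// setX0 integral_set0.
have d0 (u v : R) : u < v -> 0 < (v - u) / 2 by move=> uv; rewrite divr_gt0// subr_gt0.
rewrite integral_mkcond.
rewrite -[RHS](window_orthogonal (- ((x + y) / 2), - ((x' + y') / 2))
  sh h0 (d0 _ _ xy) (d0 _ _ xy')).
apply: eq_integral => -[s t] _; rewrite /shift/= -!itv_window// patchE.
rewrite (_ : (s, t) \in _ = (s \in `]x, y[) && (t \in `]x', y'[)); last first.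
  by apply/idP/idP => [/set_mem[/= -> ->]//|/andP[? ?]]; apply/mem_set.
case: (s \in `]x, y[); case: (t \in `]x', y'[) => /=; by rewrite ?(mulr0, mul0r, mulr1).
Qed.

End rectangles.

(** * Injectivity and uniqueness of the Fourier-Plancherel transform *)

Section dynkin.
Context d1 d2 (X : measurableType d1) (Y : measurableType d2) (R : realType).
Variable m : {measure set X -> \bar R}.

(** If the integral of [w] vanishes on the preimages of a generating set stable under
    intersection, then it vanishes on the preimages of all measurable sets. *)
Lemma integral_dynkin0 (D : set X) (w : X -> \bar R) (phi : X -> Y) (G : set (set Y)) :
  measurable D -> m.-integrable D w -> measurable_fun setT phi ->
  @measurable _ Y = <<s G >> -> setI_closed G ->
  (\int[m]_(x in D) w x = 0)%E ->
  (forall S, G S -> (\int[m]_(x in D `&` phi @^-1` S) w x = 0)%E) ->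
  forall S, measurable S -> (\int[m]_(x in D `&` phi @^-1` S) w x = 0)%E.
Proof.
move=> mD iw mphi mG GI D0 G0 S mS.
have mpre A : measurable A -> measurable (D `&` phi @^-1` A).
  by move=> mA; apply: measurableI => //; rewrite -[X in measurable X]setTI; exact: mphi.
have iS A : measurable A -> m.-integrable (D `&` phi @^-1` A) w.
  by move=> mA; apply: (integrableS mD) => //; exact: mpre.
move: S mS; rewrite mG; apply: (dynkin_induction mG GI) => //.
- by rewrite preimage_setT setIT.
- move=> A mA HA.
  have : (\int[m]_(x in (D `&` phi @^-1` A) `|` (D `&` phi @^-1` (~` A))) w x = 0)%E.
    by rewrite -setIUr -preimage_setU setUv preimage_setT setIT.
  rewrite integral_setU ?HA ?add0e//.
  + exact: mpre.
  + by apply: mpre; exact: measurableC.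
  + rewrite -setIUr -preimage_setU setUv preimage_setT setIT.
    exact: measurable_int iw.
  + by apply/disj_set2P; rewrite setIACA setIid -preimage_setI setICr preimage_set0 setI0.
- move=> F mF tF HF.
  rewrite preimage_bigcup setI_bigcupr integral_bigcup//.
  + by apply: eseries0 => n _ _; exact: HF.
  + apply/trivIsetP => i j _ _ ij; rewrite setIACA setIid -preimage_setI.
    by have /trivIsetP -> := tF => //; rewrite preimage_set0 setI0.
  + by move=> k; exact: mpre.
  + rewrite -setI_bigcupr -preimage_bigcup; apply: iS.
    exact: bigcupT_measurable.
Qed.

End dynkin.

Section uniqueness.
Context (R : realType).
Notation mu := (@lebesgue_measure R).
Notation leb := (leb2 R).
Notation L := (measurableTypeR R).
Notation R2 := (measurableTypeR R * measurableTypeR R)%type.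

(** The open intervals, a generating set of the Borel sets of the line. *)
Let G : set (set L) := [set A | exists x y, A = `]x, y[%classic].

Let GE : @measurable _ L = <<s G >>.
Proof. exact: (RGenOpens.measurableE R). Qed.

Let GI : setI_closed G.
Proof.
move=> _ _ [x [y ->]] [x' [y' ->]].
exists (Num.max x x'), (Num.min y y'); apply/seteqP; split => t /=;
  rewrite !in_itv/= lt_min gt_max.
  by move=> [/andP[-> ->] /andP[-> ->]].
by move=> /andP[/andP[-> ->] /andP[-> ->]].
Qed.

Lemma rectangles_ae0 (h : R2 -> R) : sqint leb h ->
  (forall x y x' y' : R,
    (\int[leb]_(z in `]x, y[%classic `*` `]x', y'[%classic) (h z)%:E = 0)%E) ->
  {ae leb, forall z, h z = 0}.
Proof.
move=> sh h0.
have mh : measurable_fun setT h by case: sh.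
(* The function need not be integrable on the plane, hence the boxes [B n * B n]. *)
pose B (n : nat) : set L := `](- n%:R), n%:R[%classic.
have mB n : measurable (B n) by exact: measurable_itv.
have mBB n : measurable (B n `*` B n : set R2) by exact: measurableX.
have GB n : G (B n) by exists (- n%:R), n%:R.
have muB n : (mu (B n) < +oo)%E.
  rewrite (lebesgue_measure_itv `](- n%:R), n%:R[%R)/=.
  by case: ifP => //; rewrite -EFinB ltry.
have h0G I J : G I -> G J -> (\int[leb]_(z in I `*` J) (h z)%:E = 0)%E.
  by move=> [x [y ->]] [x' [y' ->]].
have ih n : leb.-integrable (B n `*` B n) (EFin \o h).
  apply/(integrable_mkcond _ (mBB n)).
  have s1 : sqint leb (\1_(B n `*` B n) : R2 -> R).
    split; first exact: measurable_indic.
    rewrite (_ : (fun x => _) = fun x => (\1_(B n `*` B n) x)%:E); last first.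
      by apply/funext => x; rewrite indicE; case: (_ \in _); rewrite ?expr1n ?expr0n.
    rewrite integral_indic// setIT /leb2/= product_measure1E//.
    by apply: lte_mul_pinfty; [exact: measure_ge0|
      rewrite ge0_fin_numE; [exact: muB|exact: measure_ge0]|exact: muB].
  have := sqint_mul sh s1; congr (_.-integrable _ _); apply/funext => x.
  by rewrite patchE indicE; case: (_ \in _) => /=; rewrite ?mulr1 ?mulr0.
have E n : {ae leb, forall z, (B n `*` B n) z -> (h z)%:E = 0%E}.
  apply: integral_ae_eq => //.
  move=> S0 S0B mS0; rewrite integral0 -(setIidr S0B).
  pose R2G : set (set R2) := [set A `*` C | A in measurable & C in measurable].
  apply: (@integral_dynkin0 _ _ _ _ _ leb (B n `*` B n) (EFin \o h) id R2G) => //.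
  - by rewrite measurable_prod_measurableType.
  - move=> _ _ [A1 mA1 [A2 mA2 <-]] [C1 mC1 [C2 mC2 <-]].
    exists (A1 `&` C1); first exact: measurableI.
    by exists (A2 `&` C2); [exact: measurableI|rewrite setXI].
  - exact: h0G.
  move=> _ [A mA [C mC <-]].
  rewrite preimage_id -setXI.
  (* The two factors of a rectangle are made arbitrary one after the other. *)
  have iBA C' A' : measurable C' -> measurable A' ->
      leb.-integrable ((B n `&` A') `*` (B n `&` C')) (EFin \o h).
    move=> mC' mA'; apply: (integrableS (mBB n)) => //.
      by apply: measurableX; exact: measurableI.
    by move=> [s t] [[? ?] [? ?]].
  have H1 J : G J -> (\int[leb]_(z in (B n `&` A) `*` (B n `&` J)) (h z)%:E = 0)%E.
    move=> GJ.
    have mJ : measurable J by case: GJ => [x [y ->]]; exact: measurable_itv.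
    have e A' : (B n `*` (B n `&` J)) `&` fst @^-1` A' = (B n `&` A') `*` (B n `&` J).
      by apply/seteqP; split => [[s t] /= [[? []] ?]//|[s t] /= [[? ?] []]].
    rewrite -e; apply: (@integral_dynkin0 _ _ _ _ _ leb
      (B n `*` (B n `&` J)) (EFin \o h) fst G) => //.
    - by apply: measurableX => //; exact: measurableI.
    - by have := iBA J setT mJ measurableT; rewrite setIT.
    - by apply: h0G => //; exact: GI.
    - by move=> I GI'; rewrite e; apply: h0G => //; exact: GI.
  have e C' : ((B n `&` A) `*` B n) `&` snd @^-1` C' = (B n `&` A) `*` (B n `&` C').
    by apply/seteqP; split => [[s t] /= [[[? ?] ?] ?]//|[s t] /= [[? ?] []]].
  rewrite -e; apply: (@integral_dynkin0 _ _ _ _ _ leb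
    ((B n `&` A) `*` B n) (EFin \o h) snd G) => //.
  - by apply: measurableX => //; exact: measurableI.
  - by have := iBA setT A measurableT mA; rewrite setIT.
  - by have := H1 _ (GB n); rewrite setIid.
  - by move=> I GI'; rewrite e; exact: H1.
have := ae_foralln E; apply: filterS => -[s t] H.
have [n Hn] : exists n : nat, `|s| < n%:R /\ `|t| < n%:R.
  exists (Num.truncn (Num.max `|s| `|t|)).+1.
  by split; apply: le_lt_trans (truncnS_gt _); rewrite le_max lexx ?orbT.
have Bst : (B n `*` B n) (s, t).
  by split; rewrite /B/= in_itv/= -ltr_norml; case: Hn.
by have [] := H n Bst.
Qed.

(** Injectivity of the Fourier-Plancherel transform. *)
Lemma L2ft_injective (h : R2 -> R) : L2ft h (fun=> 0) (fun=> 0) ->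
  {ae leb, forall z, h z = 0}.
Proof.
move=> h0; have [sh _ _ _] := h0.
apply: rectangles_ae0 => // x y x' y'.
apply: rectangle_orthogonal => // a b [p1 p2] a0 b0.
by have := L2ft0_tent_orthogonal (- p1, - p2) a0 b0 h0; rewrite /opp2/= !opprK.
Qed.

(** The zeros of the kernel closest to the origin, other than the origin itself, are
    at distance [c]. *)
Lemma kern_neq0 (c x : R) : 0 < c -> x != 0 -> `|x| < c -> kern c^-1 x != 0.
Proof.
move=> c0 x0 xc; rewrite /kern mulf_neq0 ?invr_eq0 ?expf_neq0//.
have H (y : R) : 0 < y -> y < 1 -> 1 - cos (2 * pi * y) != 0.
  move=> y0 y1.
  have -> : 1 - cos (2 * pi * y) = 2 * sin (pi * y) ^+ 2.
    rewrite [2 * pi * y](_ : _ = (pi * y) *+ 2); last by rewrite -mulr_natr; ring.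
    by rewrite cos_mulr2n cos2sin2 mulr2n; ring.
  rewrite mulf_neq0// expf_neq0// gt_eqF// sin_gt0_pi//.
  by rewrite mulr_gt0 ?pi_gt0//= gtr_pMr ?pi_gt0.
rewrite (_ : 2 * pi * c^-1 * x = 2 * pi * (x / c)); last ring.
have [xp|xn] := leP 0 x.
  have {}x0 : 0 < x by rewrite lt_neqAle eq_sym x0.
  apply: H; first by rewrite divr_gt0.
  by rewrite ltr_pdivrMr// mul1r -(ger0_norm xp).
rewrite -cosN -mulrN -mulNr; apply: H; first by rewrite divr_gt0 ?oppr_gt0.
by rewrite ltr_pdivrMr// mul1r -(ltr0_norm xn).
Qed.

Lemma axes_negligible : {ae leb, forall z, z.1 != 0 /\ z.2 != 0}.
Proof.
pose Z : set L := [set 0].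
have m1 : measurable Z by exact: measurable_set1.
have mu1 : mu Z = 0%E by exact: lebesgue_measure_set1.
exists ((Z `*` setT) `|` (setT `*` Z)); split.
- by apply: measurableU; exact: measurableX.
- apply: null_set_setU; [exact: measurableX|exact: measurableX| |].
    transitivity (mu Z * mu setT)%E; first exact: product_measure1E.
    by rewrite mu1 mul0e.
  transitivity (mu setT * mu Z)%E; first exact: product_measure1E.
  by rewrite mu1 mule0.
- move=> [s t] /= H; have [->|s0] := eqVneq s 0; [by left|right; split => //=].
  by apply: contrapT => /eqP t0; apply: H.
Qed.

(** The hypotheses say that the product of [A] and a kernel has a null Fourier
    transform, so that it vanishes; and the kernels vanish simultaneously only on
    the axes. *)
Lemma ae0_of_orthogonal (A : R2 -> R) : sqint leb A ->
  (forall a p, 0 <= a -> \int[leb]_x (A x * cosk a a p x) = 0) ->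
  (forall a p, 0 <= a -> \int[leb]_x (A x * sink a a p x) = 0) ->
  {ae leb, forall z, A z = 0}.
Proof.
move=> sA Ac As.
have mA : measurable_fun setT A by case: sA.
have w0 c : 0 <= c -> {ae leb, forall z, A z * kern2 c c z = 0}.
  move=> c_ge0.
  have iw : leb.-integrable setT (EFin \o (fun z => A z * kern2 c c z)).
    exact: (sqint_mul sA (sqint_kern2 c c)).
  have mw : measurable_fun setT (fun z => A z * kern2 c c z).
    by apply/measurable_EFinP; exact: measurable_int iw.
  apply: L2ft_injective.
  have c0 : ct (fun z => A z * kern2 c c z) = fun=> 0.
    apply/funext => p; rewrite -[RHS](Ac c p c_ge0); apply: eq_Rintegral => x _.
    by rewrite /cosk; ring.
  have s0 : st (fun z => A z * kern2 c c z) = fun=> 0.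
    apply/funext => p; rewrite -[RHS](As c p c_ge0); apply: eq_Rintegral => x _.
    by rewrite /sink; ring.
  have sw : sqint leb (fun z => A z * kern2 c c z).
    pose C : R := (2 * pi * c) ^+ 2 + 2.
    apply: (sqint_le (C := C * C) mw sA) => x.
    by rewrite normrM mulrC ler_wpM2r// normrM ler_pM// kern_bounded.
  split => //; [exact: sqint_0|exact: sqint_0|].
  (* The product is integrable, so its transform is the classical one. *)
  exists (fun=> fun z => A z * kern2 c c z); split => //.
  - exact: l2cvg_cst.
  - by rewrite c0; exact: l2cvg_cst.
  - by rewrite s0; exact: l2cvg_cst.
have i0 (n : nat) : (0 : R) <= n.+1%:R^-1 by rewrite invr_ge0.
have wn := ae_foralln (fun n => w0 n.+1%:R^-1 (i0 n)).
apply: ae_imply2 axes_negligible wn => -[s t] /= [s0 t0] H.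
pose n := Num.truncn (Num.max `|s| `|t|).
have ns : `|s| < n.+1%:R by apply: le_lt_trans (truncnS_gt _); rewrite le_max lexx.
have nt : `|t| < n.+1%:R by apply: le_lt_trans (truncnS_gt _); rewrite le_max lexx orbT.
have /eqP := H n; rewrite mulf_eq0 => /orP[/eqP//|].
by rewrite /kern2 mulf_eq0 (negPf (kern_neq0 _ s0 ns))// (negPf (kern_neq0 _ t0 nt)).
Qed.

(** The only transform of the null function is null: the Fourier integral is a closable
    operator. *)
Lemma L2ft_closable (A B : R2 -> R) : L2ft (fun=> 0) A B ->
  {ae leb, forall z, A z = 0} /\ {ae leb, forall z, B z = 0}.
Proof.
move=> h0; have [_ sA sB _] := h0.
have s0 := sqint_0 R.
have Z (k : R2 -> R) : \int[leb]_x (0 * k x) = 0.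
  by apply: Rintegral0 => x; rewrite mul0r.
have dual a p (a0 : 0 <= a) := L2ft_duality h0 (integrable_cosk2 a a p)
  (sqint_cosk a a p) (sqint_ct_cosk p a0 a0) (sqint_st_cosk a a p).
have duals a p (a0 : 0 <= a) := L2ft_duality h0 (integrable_sink2 a a p)
  (sqint_sink a a p) (sqint_ct_sink a a p) (sqint_st_sink p a0 a0).
split; apply: ae0_of_orthogonal => // a p a0.
- by rewrite (dual a p a0).1.
- by rewrite (duals a p a0).1.
- by rewrite (dual a p a0).2.
- by rewrite (duals a p a0).2.
Qed.

(** Single-valuedness of the Fourier-Plancherel transform, almost everywhere. *)
Lemma L2ft_unique (h A B A' B' : R2 -> R) : L2ft h A B -> L2ft h A' B' ->
  {ae leb, forall z, A z = A' z} /\ {ae leb, forall z, B z = B' z}.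
Proof.
move=> hAB hAB'; have := L2ft_comb 1 (-1) hAB hAB'.
rewrite (_ : (fun x => 1 * h x + -1 * h x) = fun=> 0); last first.
  by apply/funext => x; ring.
move=> /L2ft_closable[A0 B0]; split.
  by apply: ae_imply A0 => z /eqP; rewrite mul1r mulN1r subr_eq0 => /eqP.
by apply: ae_imply B0 => z /eqP; rewrite mul1r mulN1r subr_eq0 => /eqP.
Qed.

End uniqueness.

(** * Steerability of the Riesz transforms of an isotropic function *)

Section steering.
Context (R : realType).
Notation mu := (@lebesgue_measure R).
Notation leb := (leb2 R).
Notation L := (measurableTypeR R).
Notation R2 := (measurableTypeR R * measurableTypeR R)%type.

(** The real factor of the Riesz multiplier. *)
Definition rmul (l : 'I_2) (f : R2) : R := coord2 l f / norm2 f.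

Lemma measurable_norm2 : measurable_fun setT (fun f : R2 => norm2 f).
Proof.
apply: (measurableT_comp (continuous_measurable_fun (@sqrt_continuous R))).
by apply: measurable_funD; apply: measurable_funX.
Qed.

Lemma measurable_rmul l : measurable_fun setT (rmul l).
Proof.
apply: measurable_funM.
  by rewrite /coord2; case: (l == 0); [exact: measurable_fst|exact: measurable_snd].
exact: measurableT_comp (@measurable_invr R) measurable_norm2.
Qed.

Lemma norm2_rot c s (f : R2) : c ^+ 2 + s ^+ 2 = 1 -> norm2 (rot c s f) = norm2 f.
Proof.
move=> cs; rewrite /norm2 /rot/=; congr (Num.sqrt _).
transitivity ((c ^+ 2 + s ^+ 2) * (f.1 ^+ 2 + f.2 ^+ 2)); first ring.
by rewrite cs mul1r.
Qed.

Lemma rmul_rot0 c s (f : R2) : c ^+ 2 + s ^+ 2 = 1 ->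
  rmul 0 (rot c s f) = c * rmul 0 f + - s * rmul 1 f.
Proof. by move=> cs; rewrite /rmul (norm2_rot f cs) /coord2/=; ring. Qed.

Lemma rmul_rot1 c s (f : R2) : c ^+ 2 + s ^+ 2 = 1 ->
  rmul 1 (rot c s f) = s * rmul 0 f + c * rmul 1 f.
Proof. by move=> cs; rewrite /rmul (norm2_rot f cs) /coord2/=; ring. Qed.

(** Since [- j m (A - j B) = - m B - j (m A)], the Riesz multiplier exchanges the
    cosine and sine transforms. *)
Lemma is_riesz_L2ft l (h r : R2 -> R) : is_riesz l h r ->
  exists A B, L2ft h A B /\
    L2ft r (fun f => - (rmul l f * B f)) (fun f => rmul l f * A f).
Proof.
move=> [H /is_fourier_L2ft hH /is_fourier_L2ft rH].
exists (fun f => qre (H f)), (fun f => - qim_j (H f)); split => //.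
move: rH; congr L2ft; apply/funext => f; rewrite /riesz_multiplier -/(rmul l f);
  by case: (H f) => p q u v /=; ring.
Qed.

Lemma isotropic_rot c s (psi : R2 -> R) : c ^+ 2 + s ^+ 2 = 1 -> isotropic psi ->
  {ae leb, forall x, psi (rot c s x) = psi x}.
Proof.
move=> cs [rho Hrho].
have Hr := scales_ae (leb2_rotation cs) Hrho.
apply: ae_imply2 Hrho Hr => x -> ->.
by rewrite -[RHS](congr1 rho (norm2_rot x cs)).
Qed.

(** The Fourier transform of an isotropic function is invariant by rotation. *)
Lemma isotropic_L2ft_rot c s (psi A B : R2 -> R) : c ^+ 2 + s ^+ 2 = 1 ->
  isotropic psi -> L2ft psi A B ->
  {ae leb, forall f, A (rot c s f) = A f} /\ {ae leb, forall f, B (rot c s f) = B f}.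
Proof.
move=> cs psi_iso psiAB.
have [[mpsi _] _ _ _] := psiAB.
have rAB := L2ft_rot cs psiAB; have [_ [mA _] [mB _] _] := rAB.
apply: L2ft_unique psiAB; apply: L2ft_ae rAB => //.
- exact: isotropic_rot.
- exact: aeW.
- exact: aeW.
Qed.

(** Steerability: if a Riesz multiplier is rotated into a combination of the two Riesz
    multipliers, then so is the Riesz transform of an isotropic function. *)
Lemma riesz_steer c s al be l (psi A B r r1 r2 : R2 -> R) : c ^+ 2 + s ^+ 2 = 1 ->
  isotropic psi -> L2ft psi A B ->
  L2ft r (fun f => - (rmul l f * B f)) (fun f => rmul l f * A f) ->
  L2ft r1 (fun f => - (rmul 0 f * B f)) (fun f => rmul 0 f * A f) ->
  L2ft r2 (fun f => - (rmul 1 f * B f)) (fun f => rmul 1 f * A f) ->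
  (forall f, rmul l (rot c s f) = al * rmul 0 f + be * rmul 1 f) ->
  {ae leb, forall x, r (rot c s x) = al * r1 x + be * r2 x}.
Proof.
move=> cs psi_iso psiAB rl r1l r2l ml.
have [Ar Br] := isotropic_L2ft_rot cs psi_iso psiAB.
have D := L2ft_comb 1 (-1) (L2ft_rot cs rl) (L2ft_comb al be r1l r2l).
suff : {ae leb, forall x, 1 * (r \o rot c s) x + -1 * (al * r1 x + be * r2 x) = 0}.
  by apply: ae_imply => x /eqP; rewrite mul1r mulN1r subr_eq0 => /eqP.
apply: L2ft_injective; have [[mh _] _ _ _] := D.
apply: L2ft_ae D => //.
- exact: aeW.
- by apply: ae_imply Br => f /= ->; rewrite ml; ring.
- by apply: ae_imply Ar => f /= ->; rewrite ml; ring.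
Qed.

Lemma Rintegral_ae (f k : R2 -> R) : measurable_fun setT f -> measurable_fun setT k ->
  {ae leb, forall x, f x = k x} -> \int[leb]_x f x = \int[leb]_x k x.
Proof.
move=> mf mk fk; congr fine; apply: ae_eq_integral => //.
- exact/measurable_EFinP.
- exact/measurable_EFinP.
by apply: ae_imply fk => x -> _.
Qed.

(** The inverse of the dilation by [a] and translation by [b]. *)
Definition unscale (a : R) (b x : R2) : R2 := ((x.1 - b.1) / a, (x.2 - b.2) / a).

Lemma scales_unscale a b : 0 < a -> exists k, scales leb k (unscale a b).
Proof.
move=> a0; exists (a^-1^-1 * a^-1^-1).
have a1 : 0 < a^-1 by rewrite invr_gt0.
apply: eq_scales (leb2_affine (- (b.1 / a), - (b.2 / a)) a1) => x.
by rewrite /unscale/=; congr pair; ring.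
Qed.

(** The pairing of [g] with the dilated and translated copy of [h]. *)
Definition coef (g h : R2 -> R) (a : R) (b : R2) : R :=
  \int[leb]_x (g x * (a^-1 * h (unscale a b x))).

Lemma integrable_coef g h a b : 0 < a -> sqint leb g -> sqint leb h ->
  leb.-integrable setT (EFin \o (fun x => g x * (a^-1 * h (unscale a b x)))).
Proof.
move=> a0 sg sh; have [k sk] := scales_unscale b a0.
apply: (sqint_mul sg); have shu := scales_sqint sk sh.
have [mhu _] := shu.
apply: (sqint_le (C := `|a^-1|) _ shu) => [|x]; last by rewrite normrM.
exact: measurable_funM.
Qed.

Lemma coef_ae g h k a b : 0 < a -> sqint leb g -> sqint leb h -> sqint leb k ->
  {ae leb, forall x, h x = k x} -> coef g h a b = coef g k a b.
Proof.
move=> a0 sg sh sk hk; have [c sc] := scales_unscale b a0.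
apply: Rintegral_ae.
- by apply/measurable_EFinP; exact: measurable_int (integrable_coef b a0 sg sh).
- by apply/measurable_EFinP; exact: measurable_int (integrable_coef b a0 sg sk).
by apply: ae_imply (scales_ae sc hk) => x ->.
Qed.

Lemma coef_comb al be g h k a b : 0 < a -> sqint leb g -> sqint leb h -> sqint leb k ->
  coef g (fun x => al * h x + be * k x) a b = al * coef g h a b + be * coef g k a b.
Proof.
move=> a0 sg sh sk.
have ih := integrable_coef b a0 sg sh; have ik := integrable_coef b a0 sg sk.
rewrite /coef -!RintegralZl// -RintegralD//.
- by apply: eq_Rintegral => x _; ring.
- exact: (integrableZl measurableT al ih).
- exact: (integrableZl measurableT be ik).
Qed.

(** The wavelet coefficient in terms of rotations of the components of the wavelet. *)
Lemma cwtE (psi r1 r2 g : R2 -> R) (psip : R2 -> quat R) a b t :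
  0 < a -> sqint leb g -> sqint leb r1 -> sqint leb r2 ->
  (forall x, psip x = quat_of_real (psi x) + qI R * quat_of_real (r1 x)
                      + qJ R * quat_of_real (r2 x)) ->
  cwt psip g a t b = Quat (coef g (psi \o rot (cos (- t)) (sin (- t))) a b)
    (- coef g (r1 \o rot (cos (- t)) (sin (- t))) a b)
    (- coef g (r2 \o rot (cos (- t)) (sin (- t))) a b) 0.
Proof.
move=> a0 sg s1 s2 E; set ro := rot _ _.
have cs : cos (- t) ^+ 2 + sin (- t) ^+ 2 = 1 by exact: cos2Dsin2.
have sro : scales leb 1 ro by exact: leb2_rotation.
have p x : psip x = Quat (psi x) (r1 x) (r2 x) 0.
  by rewrite E; congr Quat => /=; ring.
rewrite /cwt /qintegral /wavelet; congr Quat.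
- by apply: eq_Rintegral => x _; rewrite p/=; rewrite /ro /rot /unscale/=; ring.
- rewrite -[RHS]mulN1r -RintegralZl//; last first.
    by apply: integrable_coef => //; exact: scales_sqint sro s1.
  by apply: eq_Rintegral => x _; rewrite p/=; rewrite /ro /rot /unscale/=; ring.
- rewrite -[RHS]mulN1r -RintegralZl//; last first.
    by apply: integrable_coef => //; exact: scales_sqint sro s2.
  by apply: eq_Rintegral => x _; rewrite p/=; rewrite /ro /rot /unscale/=; ring.
- by apply: Rintegral0 => x; rewrite p/=; ring.
Qed.

End steering.

Theorem proposition22 (R : realType) (psi : R * R -> R)
    (psip : R * R -> quat R) (g : R * R -> R)
    (psi_adm : admissible psi) (psi_iso : isotropic psi)
    (psip_ext : is_monogenic_extension psi psip)
    (g_L2 : g \in Lfun (leb2 R) 2%:E)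
    (a : R) (b : R * R) (a_gt0 : 0 < a)
    (t1 t2 : R) (ht1 : 0 <= t1 < 2 * pi) (ht2 : 0 <= t2 < 2 * pi) :
  quat_norm (cwt psip g a t1 b) = quat_norm (cwt psip g a t2 b).
Proof.
have [r1 [r2 [riesz1 riesz2 psipE]]] := psip_ext.
have sg := Lfun2_sqint g_L2.
have [A [B [psiAB r1AB]]] := is_riesz_L2ft riesz1.
have [A' [B' [psiAB' r2AB']]] := is_riesz_L2ft riesz2.
have [AA' BB'] := L2ft_unique psiAB' psiAB.
have [spsi [mA _] [mB _] _] := psiAB.
have [sr1 _ _ _] := r1AB; have [sr2 _ _ _] := r2AB'.
have r2AB : L2ft r2 (fun f => - (rmul 1 f * B f)) (fun f => rmul 1 f * A f).
  apply: L2ft_ae r2AB'.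
  - by case: sr2.
  - by apply: measurableT_comp => //; apply: measurable_funM => //; exact: measurable_rmul.
  - by apply: measurable_funM => //; exact: measurable_rmul.
  - exact: aeW.
  - by apply: ae_imply BB' => f ->.
  - by apply: ae_imply AA' => f ->.
pose W k := coef g k a b.
suff normE t : quat_norm (cwt psip g a t b) =
    Num.sqrt (W psi ^+ 2 + W r1 ^+ 2 + W r2 ^+ 2) by rewrite !normE.
pose c := cos (- t); pose s := sin (- t).
have cs : c ^+ 2 + s ^+ 2 = 1 by exact: cos2Dsin2.
have sro : scales (leb2 R) 1 (rot c s) by exact: leb2_rotation.
have steer1 := riesz_steer cs psi_iso psiAB r1AB r1AB r2AB (fun f => rmul_rot0 f cs).
have steer2 := riesz_steer cs psi_iso psiAB r2AB r1AB r2AB (fun f => rmul_rot1 f cs).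
rewrite (cwtE b t a_gt0 sg sr1 sr2 psipE) /quat_norm/= -/c -/s.
rewrite (coef_ae b a_gt0 sg (scales_sqint sro spsi) spsi (isotropic_rot cs psi_iso)).
rewrite (coef_ae b a_gt0 sg (scales_sqint sro sr1) (sqint_comb c (- s) sr1 sr2) steer1).
rewrite (coef_ae b a_gt0 sg (scales_sqint sro sr2) (sqint_comb s c sr1 sr2) steer2).
rewrite !coef_comb// -/(W psi) -/(W r1) -/(W r2); congr (Num.sqrt _).
transitivity (W psi ^+ 2 + (c ^+ 2 + s ^+ 2) * (W r1 ^+ 2 + W r2 ^+ 2)); first ring.
by rewrite cs; ring.
Qed.
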